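(* Let $s\in(1,2]$ and $m,n\in\mathbb{N}$. Then the set $H_s[0,1]\cap B_s[0,1]$ of all $f\in C[0,1]$ with $\dim_H G_f([0,1])=s$ and $\dim_B G_f([0,1])=s$ is $(n,n+m)$-lineable.
   Context: $C[0,1]$ is the real vector space of real-valued continuous functions on $[0,1]$. $G_f(X)=\{(x,f(x)):x\in X\}$. $\dim_H$ is Hausdorff dimension; $\dim_B A$ is the box dimension, i.e. $B_s[0,1]$ consists of those $f$ for which the lower and upper box dimensions of $G_f([0,1])$ coincide and equal $s$. For cardinals $\alpha<\beta$, a subset $A$ of a vector space is $\alpha$-lineable if there is an $\alpha$-dimensional linear subspace $M\subseteq A\cup\{0\}$, and $(\alpha,\beta)$-lineable if it is $\alpha$-lineable and every $\alpha$-dimensional subspace $W_\alpha\subseteq A\cup\{0\}$ is contained in some $\beta$-dimensional subspace $W_\beta\subseteq A\cup\{0\}$. *)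

(* Defs.v *)
From HB Require Import structures.
From mathcomp Require Import all_boot all_order all_algebra.
From mathcomp Require Import all_classical all_reals all_analysis.
Set Implicit Arguments. Unset Strict Implicit. Unset Printing Implicit Defensive.
Import Order.TTheory GRing.Theory Num.Theory.
Import numFieldNormedType.Exports.
Local Open Scope classical_set_scope.
Local Open Scope ring_scope.

Section Defs.
Variable R : realType.

Definition dist2 (p q : R * R) : R :=
  Num.sqrt ((p.1 - q.1) ^+ 2 + (p.2 - q.2) ^+ 2).

Definition diam_le (d : R) (U : set (R * R)) : Prop :=
  forall p q, U p -> U q -> dist2 p q <= d.

Definition diam (U : set (R * R)) : R :=
  sup [set dist2 pq.1 pq.2 | pq in U `*` U].

Definition cover_term (t : R) (U : set (R * R)) : \bar R :=
  if U == set0 then 0%E else ((diam U) `^ t)%:E.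

Definition hausdorff_pre (t d : R) (A : set (R * R)) : \bar R :=
  ereal_inf [set (\sum_(0 <= i <oo) cover_term t (U i))%E
            | U in [set U : nat -> set (R * R) |
                     A `<=` \bigcup_i U i /\ forall i, diam_le d (U i)]].

Definition hausdorff_measure (t : R) (A : set (R * R)) : \bar R :=
  ereal_sup [set hausdorff_pre t d A | d in [set d : R | 0 < d]].

Definition dimH (A : set (R * R)) : \bar R :=
  ereal_inf [set t%:E | t in [set t : R | 0 <= t /\ hausdorff_measure t A = 0%E]].

Definition Ncover (d : R) (A : set (R * R)) : \bar R :=
  ereal_inf [set (k%:R)%:E | k in [set k : nat |
     exists U : nat -> set (R * R),
       A `<=` \bigcup_(i in `I_k) U i /\ forall i, diam_le d (U i)]].

Definition box_ratio (d : R) (A : set (R * R)) : \bar R :=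
  match Ncover d A with
  | r%:E => (ln r / - ln d)%:E
  | _ => +oo%E
  end.

Definition lower_box_dim (A : set (R * R)) : \bar R :=
  ereal_sup [set ereal_inf [set box_ratio d A | d in [set d : R | 0 < d < e]]
            | e in [set e : R | 0 < e <= 1]].

Definition upper_box_dim (A : set (R * R)) : \bar R :=
  ereal_inf [set ereal_sup [set box_ratio d A | d in [set d : R | 0 < d < e]]
            | e in [set e : R | 0 < e <= 1]].

(* Elements of C[0,1] are represented by functions R -> R continuous on [0,1];
   two representatives are identified when they agree on [0,1]. *)
Definition C01 (f : R -> R) : Prop := {within `[0, 1]%classic, continuous f}.

Definition graph01 (f : R -> R) : set (R * R) :=
  [set (x, f x) | x in `[0, 1]%classic].

Definition HB_set (s : R) (f : R -> R) : Prop :=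
  C01 f /\ dimH (graph01 f) = s%:E /\
  lower_box_dim (graph01 f) = s%:E /\ upper_box_dim (graph01 f) = s%:E.

Definition lincomb (k : nat) (c : 'I_k -> R) (w : 'I_k -> R -> R) : R -> R :=
  fun x => \sum_(i < k) c i * w i x.

Definition is_zero01 (f : R -> R) : Prop := forall x, 0 <= x <= 1 -> f x = 0.

Definition lin_indep01 (k : nat) (w : 'I_k -> R -> R) : Prop :=
  forall c : 'I_k -> R, is_zero01 (lincomb c w) -> forall i, c i = 0.

Definition in_span01 (k : nat) (w : 'I_k -> R -> R) (f : R -> R) : Prop :=
  exists c : 'I_k -> R, forall x, 0 <= x <= 1 -> f x = lincomb c w x.

Definition subspace_in (A : (R -> R) -> Prop) (k : nat) (w : 'I_k -> R -> R) : Prop :=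
  (forall i, C01 (w i)) /\ lin_indep01 w /\
  forall c : 'I_k -> R, A (lincomb c w) \/ is_zero01 (lincomb c w).

Definition lineable (A : (R -> R) -> Prop) (k : nat) : Prop :=
  exists w : 'I_k -> R -> R, subspace_in A w.

Definition lineable_pair (A : (R -> R) -> Prop) (n m : nat) : Prop :=
  lineable A n /\
  forall w : 'I_n -> R -> R, subspace_in A w ->
    exists v : 'I_(n + m) -> R -> R, subspace_in A v /\ forall i, in_span01 v (w i).

End Defs.

(* Main.v *)
(** Write H = 2 - s.  By induction on the number of added dimensions it suffices
    to find, for a subspace W spanned by w_1, ..., w_k, one function f such that
    a f + w has both dimensions equal to s whenever a <> 0 and w is in W.  Take
      f(x) = \sum_l 2^-(l^2) tri(2^(e_l) x),
    where tri is the triangle wave and e_l is, roughly, the least scale at which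
    the mean oscillation of w_1, ..., w_k over the dyadic intervals of length
    2^-(e_l) drops below 2^-((l+3)^2).  Since the w_i have upper box dimension s,
    these mean oscillations are at most 2^-(e_l (H - o(1))), and minimality of
    e_l yields 2^-(l^2) = 2^-(e_l (H + o(1))).  Hence f is almost H-Hoelder, and
    as mean oscillations are subadditive, the upper box dimension of a f + w is
    at most s.

    For the Hausdorff dimension, outside a summably small proportion of the
    dyadic intervals of level l the oscillation of w is negligible compared with
    2^-((l+1)^2), so there a f + w inherits the linear expansion of the l-th
    wave.  Descending through the levels, the points x outside the exceptional
    intervals whose graph point lies in a given set of diameter r form a set of
    Lebesgue measure at most r^(s - o(1)), and the mass distribution principle
    applies. *)

Require Import Defs.
From HB Require Import structures.
From mathcomp Require Import all_boot all_order all_algebra.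
From mathcomp Require Import all_classical all_reals all_analysis.
From mathcomp Require Import lra ring zify.
Import Order.TTheory GRing.Theory Num.Theory.
Import numFieldNormedType.Exports.
Set Implicit Arguments. Unset Strict Implicit. Unset Printing Implicit Defensive.
Local Open Scope classical_set_scope.
Local Open Scope ring_scope.

(** * Lebesgue covers and dyadic cells *)

Section Covers.
Variable R : realType.
Implicit Types (X Y : set R) (L D x y : R) (e k : nat).

(* An upper bound on the outer measure, so that [X] need not be measurable. *)
Definition cov X L : Prop :=
  exists Y, [/\ measurable Y, X `<=` Y & (lebesgue_measure Y <= L%:E)%E].

Lemma cov_sub X Y L M : X `<=` Y -> L <= M -> cov Y L -> cov X M.
Proof.
move=> XY LM [Z [mZ YZ lZ]]; exists Z; split => //; first exact: subset_trans YZ.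
by apply: (le_trans lZ); rewrite lee_fin.
Qed.

Lemma cov_le X L M : L <= M -> cov X L -> cov X M.
Proof. exact: cov_sub. Qed.

Lemma cov0 L : 0 <= L -> cov set0 L.
Proof. by move=> L0; exists set0; split => //; rewrite measure0 lee_fin. Qed.

Lemma cov_itv (a b : R) : a <= b -> cov `[a, b]%classic (b - a).
Proof.
move=> ab; exists `[a, b]%classic; split => //.
rewrite lebesgue_measure_itv /= lte_fin; case: ifP => // _.
by rewrite lee_fin subr_ge0.
Qed.

Lemma cov_itvP (a b : R) L : a <= b -> cov `[a, b]%classic L -> b - a <= L.
Proof.
rewrite le_eqVlt => /orP[/eqP <-|ab] [Y [mY sY lY]].
  by rewrite subrr -lee_fin; exact: le_trans lY.
have : (lebesgue_measure (`[a, b]%classic : set R) <= L%:E)%E.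
  by apply: le_trans lY; apply: le_measure => //; rewrite inE.
by rewrite lebesgue_measure_itv /= lte_fin ab lee_fin.
Qed.

(** The interval is centred at an arbitrary point of [X] rather than spanned by its infimum and
    supremum, hence the factor 2. *)
Lemma cov_diam X D : (forall x y, X x -> X y -> `|x - y| <= D) -> 0 <= D ->
  cov X (2 * D).
Proof.
move=> h D0; have [->|/set0P[z Xz]] := eqVneq X set0; first by apply: cov0; lra.
apply: (cov_sub _ _ (@cov_itv (z - D) (z + D) _)); [|lra|lra].
by move=> x /(h _ _ Xz); rewrite ler_norml /= in_itv /= => /andP[? ?]; apply/andP; split; lra.
Qed.

Lemma cov_bigcup (K : nat) (X : nat -> set R) (L : nat -> R) :
  (forall i, (i < K)%N -> cov (X i) (L i)) ->
  cov (\bigcup_(i in `I_K) X i) (\sum_(i < K) L i).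
Proof.
elim: K => [|K IH] h.
  by rewrite II0 bigcup_set0 big_ord0; exact: cov0.
have [Y [mY sY lY]] := IH (fun i iK => h i (ltnW iK)).
have [Z [mZ sZ lZ]] := h K (ltnSn K).
exists (Y `|` Z); split; first exact: measurableU.
  move=> x [i /=]; rewrite ltnS leq_eqVlt => /orP[/eqP->|iK] Xx; first by right; exact: sZ.
  by left; apply: sY; exists i.
rewrite big_ord_recr /= EFinD; apply: le_trans (leeD lY lZ).
exact: measureU2.
Qed.

Lemma cov_bigcup_mem (K : nat) (b : nat -> bool) (X : nat -> set R) L :
  (forall i, (i < K)%N -> b i -> cov (X i) L) ->
  cov (\bigcup_(i in [set i | (i < K)%N /\ b i]) X i) (L * (\sum_(i < K) b i)%:R).
Proof.
move=> h.
have := @cov_bigcup K (fun i => if b i then X i else set0) (fun i => if b i then L else 0).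
move=> /(_ _)[].
  by move=> i iK; case: ifP => bi; [exact: h|exact: cov0].
move=> Y [mY sY lY]; exists Y; split => //.
  by move=> x [i /= [iK bi] Xx]; apply: sY; exists i => //; rewrite bi.
apply: (le_trans lY); rewrite lee_fin natr_sum mulr_sumr; apply: ler_sum => i _.
by case: (b i); rewrite ?mulr1 ?mulr0.
Qed.

(** Half-open, so that the cells of one level partition the nonnegative reals. The point 1 lies in
    no cell of index below [2 ^ e] and is treated separately. *)
Definition in_cell e k x : bool := k%:R <= x * 2 ^+ e < k.+1%:R.

Lemma exp2_gt0 e : 0 < 2 ^+ e :> R. Proof. exact: exprn_gt0. Qed.
Local Hint Resolve exp2_gt0 : core.

Lemma in_cell_dist e k x y : in_cell e k x -> in_cell e k y ->
  `|x - y| * 2 ^+ e <= 1.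
Proof.
rewrite /in_cell -[k.+1%:R]natr1 => /andP[? ?] /andP[? ?].
have -> : `|x - y| * 2 ^+ e = `|x * 2 ^+ e - y * 2 ^+ e|.
  by rewrite -mulrBl normrM (gtr0_norm (exp2_gt0 e)).
rewrite ler_norml.
by apply/andP; split; lra.
Qed.

Lemma cov_cell e k : cov [set x | in_cell e k x] (2 ^- e).
Proof.
have h := exp2_gt0 e.
have E : 2 ^- e = (k.+1%:R / 2 ^+ e) - (k%:R / 2 ^+ e) :> R.
  by rewrite -mulrBl -[k.+1%:R]natr1 [k%:R + 1]addrC addrK mul1r.
rewrite E; apply: cov_sub (lexx _) (cov_itv _); last first.
  by rewrite ler_pM2r ?invr_gt0// ler_nat.
move=> x /=; rewrite /in_cell in_itv /= => /andP[a b].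
by rewrite ler_pdivrMr// ler_pdivlMr// a ltW.
Qed.

Lemma in_cell_truncn e x : 0 <= x -> in_cell e (Num.truncn (x * 2 ^+ e)) x.
Proof. by move=> x0; apply: truncn_itv; rewrite mulr_ge0// ltW. Qed.

Lemma in_cell_lt e k x : x < 1 -> in_cell e k x -> (k < 2 ^ e)%N.
Proof.
move=> x1 /andP[kx _]; rewrite -(ltr_nat R) natrX; apply: (le_lt_trans kx).
by rewrite -[ltRHS]mul1r ltr_pM2r.
Qed.

Lemma cell_in01 e k x : (k < 2 ^ e)%N -> in_cell e k x -> 0 <= x < 1.
Proof.
move=> k2 /andP[kx xk]; have h := exp2_gt0 e; apply/andP; split.
  by rewrite -(pmulr_lge0 _ h); apply: le_trans kx.
rewrite -(ltr_pM2r h) mul1r; apply: (lt_le_trans xk).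
by rewrite -natrX ler_nat.
Qed.

Lemma cov_cells Y D e L : 0 <= D -> 0 <= L ->
  (forall x, Y x -> 0 <= x) ->
  (forall x y, Y x -> Y y -> `|x - y| <= D) ->
  (forall k, cov (Y `&` [set x | in_cell e k x]) L) ->
  cov Y ((2 * D * 2 ^+ e + 2) * L).
Proof.
move=> D0 L0 Y0 YD hL; have h := exp2_gt0 e.
have DM : 0 <= 2 * D * 2 ^+ e by rewrite !mulr_ge0// ltW.
have [->|/set0P[z Yz]] := eqVneq Y set0.
  by apply: cov0; rewrite mulr_ge0// addr_ge0.
(* [Y] lies in the window from [u] to [u + 2 * D]. Clipping at 0 puts [u] in a cell, and the [N]
   consecutive cells from there on cover the window. *)
pose u := Num.max 0 (z - D).
have u0 : 0 <= u by rewrite le_max lexx.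
have uz : u <= z by rewrite ge_max Y0//= lerBlDr lerDl.
have zu : z - D <= u by rewrite le_max lexx orbT.
pose k0 := Num.truncn (u * 2 ^+ e).
have /andP[k0a k0b] : in_cell e k0 u := in_cell_truncn e u0.
pose N := (Num.truncn (2 * D * 2 ^+ e)).+2.
have hN : N%:R <= 2 * D * 2 ^+ e + 2.
  have /andP[? _] := truncn_itv DM; rewrite /N -natr1 -[_.+1%:R]natr1; lra.
apply: (cov_sub _ _ (@cov_bigcup N (fun i => Y `&` [set x | in_cell e (k0 + i) x]) (fun=> L) _)).
- move=> x Yx; have x0 := Y0 _ Yx.
  have /andP[ka kb] := in_cell_truncn e x0; set k := Num.truncn _ in ka kb.
  have ux : u <= x by rewrite ge_max x0/=; have := YD _ _ Yz Yx; rewrite ler_norml => /andP[? ?]; lra.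
  have xu : x <= u + 2 * D by have := YD _ _ Yz Yx; rewrite ler_norml => /andP[? ?]; lra.
  have k0k : (k0 <= k)%N.
    by apply: le_truncn; rewrite ler_pM2r.
  have /andP[_ DN] := truncn_itv DM.
  have xu2 : x * 2 ^+ e <= (u + 2 * D) * 2 ^+ e by rewrite ler_pM2r.
  have kN : (k < k0 + N)%N.
    rewrite /N -addSnnS -(ltr_nat R); apply: (le_lt_trans ka); apply: (le_lt_trans xu2).
    by rewrite mulrDl natrD ltrD.
  exists (k - k0)%N; last by split => //=; rewrite subnKC// /in_cell ka.
  suff : (k - k0 < N)%N by [].
  by rewrite -(ltn_add2l k0) subnKC.
- by rewrite sumr_const card_ord -[leLHS]mulr_natl ler_wpM2r.
- by move=> i _; exact: hL.
Qed.

End Covers.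

(** * Mean oscillation over dyadic cells *)

Section MeanOscillation.
Variable R : realType.
Implicit Types (D : R -> R -> R) (g : R -> R) (e k : nat) (V x y : R).

(* The oscillations are bounded by a witness [o] instead of being suprema, which
   makes [mosc] monotone and subadditive without boundedness conditions. *)
Definition mosc D e V : Prop := exists o : nat -> R,
  (forall k x y, (k < 2 ^ e)%N -> in_cell e k x -> in_cell e k y -> D x y <= o k)
  /\ 2 ^- e * (\sum_(k < 2 ^ e) o k) <= V.

Local Notation exp2_gt0 := (@exp2_gt0 R).

Lemma mosc_sub D D' e V V' :
  (forall x y, 0 <= x < 1 -> 0 <= y < 1 -> D x y <= D' x y) -> V' <= V ->
  mosc D' e V' -> mosc D e V.
Proof.
move=> hD hVV [ o [ho hV]]; exists o; split; last exact: le_trans hVV.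
move=> k x y k2 kx ky; apply: le_trans (ho _ _ _ k2 kx ky).
by apply: hD; [exact: cell_in01 kx|exact: cell_in01 ky].
Qed.

Lemma mosc_add D D' e V V' : mosc D e V -> mosc D' e V' ->
  mosc (fun x y => D x y + D' x y) e (V + V').
Proof.
move=> [ o [ho hV]] [ o' [ho' hV']]; exists (fun k => o k + o' k); split.
  by move=> k x y k2 kx ky; apply: lerD; [exact: ho|exact: ho'].
by rewrite big_split /= mulrDr lerD.
Qed.

Lemma mosc_scale D e V c : 0 <= c -> mosc D e V ->
  mosc (fun x y => c * D x y) e (c * V).
Proof.
move=> c0 [ o [ho hV]]; exists (fun k => c * o k); split.
  by move=> k x y k2 kx ky; rewrite ler_wpM2l// ho.
by rewrite -mulr_sumr mulrCA ler_wpM2l.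
Qed.

Lemma mosc_const D e V :
  (forall k x y, (k < 2 ^ e)%N -> in_cell e k x -> in_cell e k y -> D x y <= V) ->
  mosc D e V.
Proof.
move=> h; exists (fun=> V); split => //.
rewrite sumr_const card_ord -[V *+ _]mulr_natl natrX mulrA mulVf ?mul1r//.
Qed.

Lemma mosc_sum n (D : 'I_n -> R -> R -> R) e V : (forall i, mosc (D i) e V) ->
  mosc (fun x y => \sum_(i < n) D i x y) e (n%:R * V).
Proof.
elim: n D => [|n IH] D h.
  by apply: mosc_const => k x y _ _ _; rewrite big_ord0 mul0r.
have := mosc_add (IH (fun i => D (widen_ord (leqnSn n) i)) (fun i => h _)) (h ord_max).
by apply: mosc_sub => [x y _ _|]; rewrite ?big_ord_recr//= -natr1 mulrDl mul1r.
Qed.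

Lemma dist2_ge1 (p q : R * R) : `|p.1 - q.1| <= dist2 p q.
Proof. by rewrite -sqrtr_sqr ler_sqrt ?addr_ge0 ?sqr_ge0// lerDl sqr_ge0. Qed.

Lemma dist2_ge2 (p q : R * R) : `|p.2 - q.2| <= dist2 p q.
Proof. by rewrite -sqrtr_sqr ler_sqrt ?addr_ge0 ?sqr_ge0// lerDr sqr_ge0. Qed.

Lemma dist2_le (p q : R * R) h : `|p.1 - q.1| <= h -> `|p.2 - q.2| <= h ->
  dist2 p q <= 2 * h.
Proof.
move=> h1 h2; have h0 : 0 <= h by apply: le_trans h1.
rewrite -[leRHS]ger0_norm ?mulr_ge0// -sqrtr_sqr ler_sqrt ?sqr_ge0//.
rewrite -[(p.1 - _) ^+ 2]real_normK ?num_real// -[(p.2 - _) ^+ 2]real_normK ?num_real//.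
have : `|p.1 - q.1| ^+ 2 <= h ^+ 2 by rewrite ler_sqr ?nnegrE.
have : `|p.2 - q.2| ^+ 2 <= h ^+ 2 by rewrite ler_sqr ?nnegrE.
have := sqr_ge0 h; rewrite exprMn; lra.
Qed.

Lemma sum_nbhd_le3 N k0 (b : nat -> bool) :
  (forall k, b k -> (k <= k0.+1)%N /\ (k0 <= k.+1)%N) ->
  (\sum_(k < N) b k <= 3)%N.
Proof.
move=> h.
have one (p : pred nat) j : (forall k, p k -> k = j) -> (\sum_(k < N) p k <= 1)%N.
  move=> pj; rewrite -(big_mkord xpredT (fun k => p k : nat)).
  have [|] := boolP (p j && (j < N)%N).
    case/andP => pj' jN; rewrite (@big_cat_nat _ _ _ j) ?(ltnW jN)//=.
    rewrite big_nat big1 ?add0n; last first.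
      move=> i /andP[_ ij]; case: (boolP (p i)) => // /pj E.
      by rewrite E ltnn in ij.
    rewrite big_ltn// pj' big_nat big1 ?addn0// => i /andP[ji _].
    by case: (boolP (p i)) => // /pj E; rewrite E ltnn in ji.
  move=> nj; rewrite big_nat big1// => i /= iN.
  by case: (boolP (p i)) => // pi; move: nj; rewrite -(pj _ pi) pi iN.
have h1 := @one (fun k => k == k0) k0 (fun k => eqP).
have h2 := @one (fun k => k == k0.+1) k0.+1 (fun k => eqP).
(* For [k0 = 0] this repeats the index 0, which only weakens the bound. *)
have h3 := @one (fun k => k == k0.-1) k0.-1 (fun k => eqP).
apply: leq_trans (leq_add (leq_add h1 h2) h3).
rewrite -!big_split /=; apply: leq_sum => k _.
case: (boolP (b k)) => // /h [? ?].
by case: eqP => //; case: eqP => //; case: eqP => //; lia.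
Qed.

Lemma within_sub (a b : R) g : 0 <= a -> b <= 1 -> C01 g ->
  {within `[a, b]%classic, continuous g}.
Proof.
move=> a0 b1; apply: continuous_subspaceW => x /=; rewrite !in_itv /= => /andP[? ?].
by apply/andP; split; lra.
Qed.

(* A cell meeting N of the covering sets has oscillation at most 2 N 2^-e by
   the intermediate value theorem, and a set of diameter 2^-e meets at most
   three cells. *)
Lemma mosc_of_cover g e K (U : nat -> set (R * R)) : C01 g ->
  graph01 g `<=` \bigcup_(i in `I_K) U i -> (forall i, diam_le (2 ^- e) (U i)) ->
  mosc (fun x y => `|g x - g y|) e (6 * K%:R * (2 ^- e * 2 ^- e)).
Proof.
move=> cg gU dU; have h := exp2_gt0 e.
have h' : 0 < 2 ^- e :> R by rewrite invr_gt0.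
pose b k i := `[< exists x, in_cell e k x /\ U i (x, g x) >].
exists (fun k => (2 * 2 ^- e) * (\sum_(i < K) b k i)%:R); split.
  move=> k x y k2; wlog xy : x y / x <= y.
    move=> H kx ky; have [xy|yx] := leP x y; first exact: H.
    by rewrite distrC; apply: H => //; exact: ltW.
  move=> kx ky; have /andP[x0 x1] := cell_in01 k2 kx; have /andP[y0 y1] := cell_in01 k2 ky.
  pose u := Num.min (g x) (g y); pose v := Num.max (g x) (g y).
  have -> : `|g x - g y| = v - u.
    rewrite /u /v; have [h1|/ltW h1] := leP (g x) (g y).
      by rewrite ler0_norm ?subr_le0// opprB.
    by rewrite ger0_norm ?subr_ge0.
  (* The length of the interval between the two values is compared with the outer measures of the
     vertical projections of the sets meeting the cell. *)
  apply: cov_itvP; first by rewrite /u /v ge_min !le_max !lexx.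
  apply: cov_sub (lexx _) (@cov_bigcup_mem R K (b k)
     (fun i => [set z | exists x, [/\ in_cell e k x, U i (x, g x) & z = g x]]) (2 * 2 ^- e) _).
    move=> z /=; rewrite in_itv /= => uzv.
    have [c] := IVT xy (within_sub x0 (ltW y1) cg) uzv.
    rewrite in_itv /= => /andP[xc cy] gc.
    have [|i iK Ui] := gU (c, g c); first by exists c => //=; rewrite in_itv /=; apply/andP; split; lra.
    have kc : in_cell e k c.
      move: kx ky; rewrite /in_cell => /andP[kx _] /andP[_ ky]; apply/andP; split.
        by apply: (le_trans kx); rewrite ler_pM2r.
      by apply: le_lt_trans ky; rewrite ler_pM2r.
    exists i; last by exists c.
    by split => //; apply/asboolP; exists c.
  move=> i iK _; apply: cov_diam; last exact: ltW.
  move=> _ _ [c [_ Uc ->]] [d [_ Ud ->]].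
  exact: le_trans (dist2_ge2 (c, g c) (d, g d)) (dU _ _ _ Uc Ud).
(* The incidences are now counted by covering set instead of by cell: at most three for each, whence
   the constant 6 = 2 * 3. *)
have -> : \sum_(k < 2 ^ e) (2 * 2 ^- e) * (\sum_(i < K) b k i)%:R
   = (2 * 2 ^- e) * (\sum_(i < K) \sum_(k < 2 ^ e) b k i)%:R :> R.
  by rewrite exchange_big natr_sum mulr_sumr.
have : ((\sum_(i < K) \sum_(k < 2 ^ e) b k i)%:R <= 3 * K%:R :> R).
  rewrite -natrM ler_nat mulnC -[X in (X * 3)%N]card_ord -sum_nat_const.
  apply: leq_sum => i _; have [[k0 bk0]|nb] := pselect (exists k, b k i); last first.
    by rewrite big1// => k _; case: (boolP (b k i)) => // bk; case: nb; exists k.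
  apply: (@sum_nbhd_le3 _ k0 (fun k => b k i)) => k /asboolP[x [kx Ux]].
  move/asboolP: bk0 => [y [ky Uy]].
  have := le_trans (dist2_ge1 (x, g x) (y, g y)) (dU _ _ _ Ux Uy).
  rewrite /= -(ler_pM2r h) mulVf ?gt_eqF// => xy.
  have {xy} : `|x * 2 ^+ e - y * 2 ^+ e| <= 1.
    by rewrite -mulrBl normrM (gtr0_norm h).
  move: kx ky; rewrite /in_cell ler_norml => /andP[? ?] /andP[? ?] /andP[? ?].
  split; rewrite -ltnS -(ltr_nat R); [rewrite -[k0.+2%:R]natr1|rewrite -[k.+2%:R]natr1]; lra.
set S := (X in X%:R <= _) => hS.
have : (2 ^- e * 2 ^- e) * S%:R <= (2 ^- e * 2 ^- e) * (3 * K%:R) :> R.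
  by rewrite ler_pM2l ?mulr_gt0.
lra.
Qed.

End MeanOscillation.

(** * The triangle wave *)

Section TriangleWave.
Variable R : realType.
Implicit Types x y : R.

(** The distance to the nearest even integer. The period is 2, so that the affine pieces have length
    1 and, after rescaling, are the dyadic cells. *)
Definition tri x : R := `|x - (2 * Num.floor ((x + 1) / 2))%:~R|.

Lemma tri_le1 x : tri x <= 1.
Proof.
rewrite /tri intrM; have /andP[] := floor_itv ((x + 1) / 2).
rewrite intrD /= => ? ?; rewrite ler_norml; apply/andP; split; lra.
Qed.

Lemma tri_le x (j : int) : tri x <= `|x - (2 * j)%:~R|.
Proof.
rewrite /tri; set m := Num.floor _.
have [->//|jm] := eqVneq j m.
apply: (le_trans (tri_le1 x)).
have /andP[] := floor_itv ((x + 1) / 2); rewrite -/m intrD /= => h1 h2.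
have : (j + 1 <= m) || (m + 1 <= j) by move: jm; lia.
case/orP; rewrite -(ler_int R) intrD intrM /= => h.
  by rewrite ler_normr; apply/orP; left; lra.
by rewrite ler_normr; apply/orP; right; lra.
Qed.

Lemma tri_ge0 x : 0 <= tri x. Proof. exact: normr_ge0. Qed.

Lemma tri_lip x y : `|tri x - tri y| <= `|x - y|.
Proof.
wlog h : x y / tri y <= tri x.
  by move=> H; have [?|/ltW ?] := leP (tri y) (tri x); [|rewrite distrC [leRHS]distrC]; exact: H.
rewrite ger0_norm ?subr_ge0// lerBlDr; apply: (le_trans (tri_le x (Num.floor ((y + 1) / 2)))).
rewrite /tri; apply: le_trans (ler_normD _ _).
by rewrite addrA subrK.
Qed.

Lemma tri_even x (j : int) : `|x - (2 * j)%:~R| <= 1 -> tri x = `|x - (2 * j)%:~R|.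
Proof.
move=> h; apply/eqP; rewrite eq_le tri_le /= /tri; set m := Num.floor _.
have [->//|jm] := eqVneq j m.
apply: (le_trans h).
have /andP[] := floor_itv ((x + 1) / 2); rewrite -/m intrD /= => h1 h2.
have : (j + 1 <= m) || (m + 1 <= j) by move: jm; lia.
rewrite intrM.
case/orP; rewrite -(ler_int R) intrD /= => hj; move: h; rewrite intrM ler_norml => /andP[? ?].
  by rewrite ler_normr; apply/orP; right; lra.
by rewrite ler_normr; apply/orP; left; lra.
Qed.

(** The nearest even integer is [k] or [k + 1] throughout the interval, according to the parity of
    [k], so [tri] is affine there with slope 1 or -1. *)
Lemma tri_cell (k : nat) x y : k%:R <= x < k.+1%:R -> k%:R <= y < k.+1%:R ->
  `|tri x - tri y| = `|x - y|.
Proof.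
rewrite -[k.+1%:R]natr1 => /andP[kx xk] /andP[ky yk].
have E : k%:R = (odd k)%:R + 2 * (k./2)%:R :> R.
  by rewrite -{1}(odd_double_half k) natrD -muln2 natrM mulrC.
case: (odd k) E => /= E; last first.
  rewrite !(@tri_even _ (k./2 : int)) intrM /= -?pmulrn ?ler_norml; last 2 first.
  - by apply/andP; split; lra.
  - by apply/andP; split; lra.
  rewrite (@ger0_norm _ (x - _)); last by lra.
  rewrite (@ger0_norm _ (y - _)); last by lra.
  by apply: congr1; ring.
rewrite !(@tri_even _ ((k./2).+1 : int)) intrM /= -?pmulrn -?[(k./2).+1%:R]natr1 ?ler_norml; last 2 first.
- by apply/andP; split; lra.
- by apply/andP; split; lra.
rewrite (@ler0_norm _ (x - _)); last by lra.
rewrite (@ler0_norm _ (y - _)); last by lra.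
by rewrite [RHS]distrC; apply: congr1; ring.
Qed.

End TriangleWave.

(** * Box dimension *)

Section BoxDimension.
Variable R : realType.
Implicit Types (A : set (R * R)) (d t : R) (K e : nat).

Lemma half_lt (x : R) : 0 < x -> exists e0, forall e, (e0 <= e)%N -> 2 ^- e < x.
Proof.
move=> x0; have [e0 _ h] := near_infty_natSinv_expn_lt (PosNum x0).
by exists e0 => e /h /=; rewrite div1r.
Qed.

Lemma ex_minimal (P : nat -> Prop) : (exists n, P n) ->
  exists n, P n /\ forall m, P m -> (n <= m)%N.
Proof.
move=> [n Pn]; have ex : exists n, `[< P n >] by exists n; apply/asboolP.
case: (ex_minnP ex) => m /asboolP Pm h; exists m; split => // k Pk.
by apply: h; apply/asboolP.
Qed.

Lemma dyadic_le (d : R) : 0 < d < 1 -> exists e, 2 ^- e <= d < 2 * 2 ^- e.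
Proof.
move=> /andP[d0 d1].
have [|e [he hm]] := @ex_minimal (fun e => 2 ^- e <= d).
  by have [e0 h] := half_lt d0; exists e0; apply/ltW/h.
exists e; rewrite he /=; case: e he hm => [|e] he hm.
  by move: he; rewrite expr0 invr1 leNgt d1.
rewrite exprS invfM mulrA mulfV ?mul1r//; rewrite ltNge; apply/negP => /hm.
by rewrite ltnn.
Qed.

Definition coverable A K d : Prop := exists U : nat -> set (R * R),
  A `<=` \bigcup_(i in `I_K) U i /\ forall i, diam_le d (U i).

Lemma coverable_bigcup N (A : nat -> set (R * R)) (K : nat -> nat) d :
  (forall k, (k < N)%N -> coverable (A k) (K k) d) ->
  coverable (\bigcup_(k in `I_N) A k) (\sum_(k < N) K k) d.
Proof.
elim: N => [|N IH] h.
  by exists (fun=> set0); rewrite II0 bigcup_set0; split => // i p q [].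
have [U [hU dU]] := IH (fun k kN => h k (ltnW kN)).
have [V [hV dV]] := h N (ltnSn N).
set S := (\sum_(k < N) K k)%N in hU.
exists (fun i => if (i < S)%N then U i else V (i - S)%N); split; last first.
  by move=> i; case: ifP.
move=> p [k /=]; rewrite ltnS leq_eqVlt big_ord_recr /= -/S => /orP[/eqP ->|kN] Ap.
  have [i /= iK Vi] := hV _ Ap; exists (S + i)%N; first by rewrite /= ltn_add2l.
  by rewrite ltnNge leq_addr /= addKn.
have [|i /= iS Ui] := hU p; first by exists k.
exists i; last by rewrite iS.
by rewrite /=; apply: (leq_trans iS); exact: leq_addr.
Qed.

Lemma coverable_sub A B K d d' : A `<=` B -> d <= d' -> coverable B K d ->
  coverable A K d'.
Proof.
move=> AB dd [U [BU dU]]; exists U; split; first exact: subset_trans BU.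
by move=> i p q Up Uq; apply: le_trans dd; exact: (dU i).
Qed.

Lemma Ncover_attained A d K : coverable A K d ->
  exists K', [/\ (K' <= K)%N, coverable A K' d & Ncover d A = (K'%:R)%:E].
Proof.
move=> cK; have [|K' [cK' hm]] := @ex_minimal (fun K => coverable A K d).
  by exists K.
exists K'; split => //; first exact: hm.
apply/eqP; rewrite eq_le; apply/andP; split.
  by apply: ereal_inf_lbound; exists K'.
apply: le_ereal_inf_tmp => _ [k ck <-]; rewrite lee_fin ler_nat; exact: hm.
Qed.

(** Without a finite cover the infimum in [Ncover] is over the empty set and [box_ratio] is
    infinite. *)
Lemma cover_of_box_ratio A d t : 0 < d < 1 -> (box_ratio d A <= t%:E)%E ->
  exists K, coverable A K d /\ K%:R <= d `^ (- t).
Proof.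
move=> /andP[d0 d1] h.
have [[K cK]|nc] := pselect (exists K, coverable A K d); last first.
  move: h; rewrite /box_ratio /Ncover.
  rewrite (_ : [set _ | _ in _] = set0) ?ereal_inf0//.
  by apply/seteqP; split => // x [k /= ck _]; case: nc; exists k.
have [K' [_ cK' EK]] := Ncover_attained cK.
exists K'; split => //; move: h; rewrite /box_ratio EK lee_fin.
have ld : 0 < - ln d by rewrite oppr_gt0 ln_lt0// d0.
rewrite ler_pdivrMr// => h.
(* [ln 0] is 0 by convention, so the ratio carries no information when [K' = 0]. *)
have [->|K0] := posnP K'; first exact: powR_ge0.
have K0' : (K'%:R : R) \is Num.pos by rewrite posrE ltr0n.
by rewrite /powR gt_eqF// -(lnK K0') ler_expR mulNr -mulrN.
Qed.

Lemma box_ratio_of_cover A d t K : 0 < d < 1 -> 0 <= t -> coverable A K d ->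
  K%:R <= d `^ (- t) -> (box_ratio d A <= t%:E)%E.
Proof.
move=> /andP[d0 d1] t0 cK hK; have [K' [K'K _ EK]] := Ncover_attained cK.
rewrite /box_ratio EK lee_fin.
have ld : 0 < - ln d by rewrite oppr_gt0 ln_lt0// d0.
rewrite ler_pdivrMr//.
have [->|K0] := posnP K'; first by rewrite ln0// mulr_ge0// ltW.
have -> : t * - ln d = ln (d `^ (- t)) by rewrite ln_powR mulrN mulNr.
rewrite ler_ln ?posrE ?ltr0n ?powR_gt0//.
by apply: le_trans hK; rewrite ler_nat.
Qed.

Lemma lower_le_upper_box A : (lower_box_dim A <= upper_box_dim A)%E.
Proof.
apply: ge_ereal_sup => _ [e /= /andP[e0 e1] <-].
apply: le_ereal_inf_tmp => _ [e' /= /andP[e'0 e'1] <-].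
pose d := Num.min e e' / 2.
have m0 : 0 < Num.min e e' by rewrite lt_min e0.
have [me me'] : Num.min e e' <= e /\ Num.min e e' <= e' by rewrite !ge_min !lexx orbT.
apply: (@le_trans _ _ (box_ratio d A)).
  by apply: ereal_inf_lbound; exists d => //=; rewrite /d; apply/andP; split; lra.
by apply: ereal_sup_ubound; exists d => //=; rewrite /d; apply/andP; split; lra.
Qed.

Lemma upper_box_cover A s : upper_box_dim A = s%:E -> forall eps, 0 < eps ->
  exists d0, 0 < d0 <= 1 /\ forall d, 0 < d < d0 ->
    exists K, coverable A K d /\ K%:R <= d `^ (- (s + eps)).
Proof.
move=> h eps e0; have : (upper_box_dim A < (s + eps)%:E)%E.
  by rewrite h lte_fin ltrDl.
move=> /ereal_inf_lt [_ [d0 /= /andP[d00 d01] <-]] hs.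
exists d0; rewrite d00; split => // d /andP[dp dd].
apply: cover_of_box_ratio; first by rewrite dp (lt_le_trans dd).
apply/ltW; apply: le_lt_trans hs; apply: ereal_sup_ubound.
by exists d => //=; rewrite dp.
Qed.

Lemma diam_ge0_le d (U : set (R * R)) : U !=set0 -> diam_le d U ->
  0 <= diam U <= d /\ diam_le (diam U) U.
Proof.
move=> [p Up] h.
have hub : has_ubound [set dist2 pq.1 pq.2 | pq in U `*` U].
  by exists d => _ [[x y] /= [Ux Uy] <-]; exact: h.
have hd : diam_le (diam U) U.
  by move=> x y Ux Uy; apply: ub_le_sup => //; exists (x, y).
split=> //; apply/andP; split; first by apply: le_trans (hd p p Up Up); exact: sqrtr_ge0.
apply: ge_sup; first by exists (dist2 p p), (p, p).
by move=> _ [[x y] /= [Ux Uy] <-]; exact: h.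
Qed.

Lemma cover_term_ge0 t U : (0 <= cover_term t U :> \bar R)%E.
Proof. by rewrite /cover_term; case: ifP => // _; rewrite lee_fin powR_ge0. Qed.

Lemma hausdorff_pre_cover A K d delta t : 0 < t -> 0 < d <= delta -> coverable A K d ->
  (hausdorff_pre t delta A <= (K%:R * d `^ t)%:E)%E.
Proof.
move=> t0 /andP[d0 dd] [U [AU dU]].
(* The finite cover is padded with empty sets, on which [cover_term] is 0. *)
pose V i := if (i < K)%N then U i else set0.
apply: (@le_trans _ _ (\sum_(0 <= i <oo) cover_term t (V i))%E).
  apply: ereal_inf_lbound; exists V => //; split.
    by move=> p /AU [i /= iK Ui]; exists i => //; rewrite /V iK.
  move=> i p q; rewrite /V; case: ifP => // _ Up Uq.
  by apply: le_trans dd; exact: (dU i).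
rewrite (nneseries_split 0 K); last by move=> k _; exact: cover_term_ge0.
rewrite add0n eseries0; last first.
  by move=> i Ki _; rewrite /V ltnNge Ki /= /cover_term eqxx.
rewrite adde0 big_mkord.
have -> : (K%:R * d `^ t)%:E = (\sum_(i < K) (d `^ t)%:E)%E.
  by rewrite sumEFin sumr_const card_ord mulr_natl.
apply: lee_sum => i _; rewrite /V ltn_ord /cover_term; case: ifPn => [_|/set0P ne].
  by rewrite lee_fin powR_ge0.
have [/andP[h0 hd] _] := diam_ge0_le ne (dU i).
by rewrite lee_fin; apply: ge0_ler_powR => //; rewrite ?nnegrE; lra.
Qed.

(** There are arbitrarily small [d] with a cover by at most d^-(s + eps/2) sets. Its sum for the
    exponent [s + eps] is at most d^(eps/2), which tends to 0. *)
Lemma dimH_le_lower_box A s : 0 <= s -> (lower_box_dim A <= s%:E)%E ->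
  (dimH A <= s%:E)%E.
Proof.
move=> s0 hs; apply/lee_addgt0Pr => eps e0; rewrite -EFinD.
apply: ereal_inf_lbound; exists (s + eps) => //; split; first by rewrite addr_ge0// ltW.
apply/eqP; rewrite eq_le; apply/andP; split; last first.
  apply: (@le_trans _ _ (hausdorff_pre (s + eps) 1 A)); last first.
    by apply: ereal_sup_ubound; exists 1 => //=.
  apply: le_ereal_inf_tmp => _ [U _ <-]; apply: nneseries_ge0 => i _ _.
  exact: cover_term_ge0.
apply: ge_ereal_sup => _ [delta /= d0 <-].
apply/lee_addgt0Pr => eta eta0; rewrite add0e.
have r0 : 0 < eta `^ (2 / eps) by exact: powR_gt0.
pose m := Num.min 1 (Num.min delta (eta `^ (2 / eps))).
have m0 : 0 < m by rewrite !lt_min r0 d0 ltr01.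
have [m1 [md mr]] : m <= 1 /\ m <= delta /\ m <= eta `^ (2 / eps).
  by rewrite /m !ge_min !lexx !orbT.
have hm : (ereal_inf [set box_ratio d A | d in [set d : R | (0 < d < m)%R]] < (s + eps / 2)%:E)%E.
  apply: (@le_lt_trans _ _ s%:E); last by rewrite lte_fin; lra.
  by apply: le_trans hs; apply: ereal_sup_ubound; exists m => //=; rewrite m0.
have [_ [d /= /andP[dp dm] <-] hr] := ereal_inf_lt hm.
have [|K [cK hK]] := @cover_of_box_ratio A d (s + eps / 2) _ (ltW hr).
  by rewrite dp (lt_le_trans dm).
apply: le_trans (@hausdorff_pre_cover A K d delta (s + eps) _ _ cK) _; first by lra.
  by rewrite dp (le_trans (ltW dm)).
rewrite lee_fin; apply: (@le_trans _ _ (d `^ (- (s + eps / 2)) * d `^ (s + eps))).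
  by rewrite ler_wpM2r// powR_ge0.
rewrite -powRD; last by rewrite (gt_eqF dp) implybT.
rewrite (_ : - (s + eps / 2) + (s + eps) = eps / 2); last by lra.
apply: (@le_trans _ _ ((eta `^ (2 / eps)) `^ (eps / 2))).
  by apply: ge0_ler_powR; rewrite ?nnegrE; lra.
rewrite -powRrM (_ : 2 / eps * (eps / 2) = 1); last by field; lra.
by rewrite powRr1// ltW.
Qed.

Local Notation exp2_gt0 := (@exp2_gt0 R).

(** The column is filled with squares of side 2^-e, stacked from [o] below the value at the left end
    of the cell to [o] above it. *)
Lemma coverable_column (g : R -> R) e k o :
  (forall x y, in_cell e k x -> in_cell e k y -> `|g x - g y| <= o) -> 0 <= o ->
  coverable [set (x, g x) | x in [set x | in_cell e k x]]
    (Num.truncn (2 * o * 2 ^+ e)).+1 (2 * 2 ^- e).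
Proof.
move=> h o0; have p0 := exp2_gt0 e.
pose xk : R := k%:R / 2 ^+ e.
have kxk : in_cell e k xk by rewrite /in_cell /xk divfK ?gt_eqF// lexx ltr_nat /=.
pose y0 := g xk - o.
exists (fun j => [set p | in_cell e k p.1 /\ in_cell e j (p.2 - y0)]); split.
  move=> _ [x /= kx <-].
  have := h _ _ kx kxk; rewrite ler_norml /y0 => /andP[h1 h2].
  have y1 : 0 <= g x - y0 by rewrite /y0; lra.
  exists (Num.truncn ((g x - y0) * 2 ^+ e)).
    rewrite /= ltnS; apply: le_truncn; rewrite ler_pM2r// /y0; lra.
  by split => //=; exact: in_cell_truncn.
move=> j p q [p1 p2] [q1 q2]; apply: dist2_le.
  by rewrite -[leRHS]mul1r ler_pdivlMr//; exact: (in_cell_dist p1 q1).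
rewrite -[leRHS]mul1r ler_pdivlMr//; apply: le_trans (in_cell_dist p2 q2).
have -> : p.2 - y0 - (q.2 - y0) = p.2 - q.2 by ring.
by [].
Qed.

Lemma coverable_graph (g : R -> R) e V :
  mosc (fun x y => `|g x - g y|) e V ->
  exists K, coverable (graph01 g) K (2 * 2 ^- e) /\
    K%:R <= 2 * V * 2 ^+ e * 2 ^+ e + 2 * 2 ^+ e.
Proof.
move=> [ o [ho hV]]; have p0 := exp2_gt0 e.
have o0 k : (k < 2 ^ e)%N -> 0 <= o k.
  move=> k2; have kxk : in_cell e k (k%:R / 2 ^+ e : R).
    by rewrite /in_cell divfK ?gt_eqF// lexx ltr_nat /=.
  exact: le_trans (normr_ge0 _) (ho k _ _ k2 kxk kxk).
(* The extra index [2 ^ e] covers the end point of the graph at 1, which no cell contains. *)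
pose C (k : nat) : set (R * R) := if (k < 2 ^ e)%N
  then [set (x, g x) | x in [set x : R | in_cell e k x]] else [set (1, g 1)].
pose K k := if (k < 2 ^ e)%N then (Num.truncn (2 * o k * 2 ^+ e)).+1 else 1%N.
exists (\sum_(k < (2 ^ e).+1) K k)%N; split.
  apply: (@coverable_sub _ (\bigcup_(k in `I_(2 ^ e).+1) C k) _ _ _ _ (lexx _)).
    move=> q [x /=]; rewrite in_itv /= => /andP[x0 x1] <-.
    move: x1; rewrite le_eqVlt => /orP[/eqP ->|x1].
      by exists (2 ^ e)%N => //=; rewrite /C ltnn.
    have kx := in_cell_truncn e x0; have klt := in_cell_lt x1 kx.
    exists (Num.truncn (x * 2 ^+ e)); first by rewrite /= ltnS ltnW.
    by rewrite /C klt; exists x.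
  apply: coverable_bigcup => k _; rewrite /C /K; case: ifP => k2.
    by apply: coverable_column; [move=> x y; exact: ho|exact: o0].
  exists (fun=> [set (1, g 1)]); split; first by move=> p pE; exists 0%N.
  move=> i p q -> ->; apply: dist2_le.
    by rewrite subrr normr0 invr_ge0 ltW.
  by rewrite subrr normr0 invr_ge0 ltW.
rewrite big_ord_recr /= {2}/K ltnn natrD natr_sum.
apply: (@le_trans _ _ (\sum_(k < 2 ^ e) (2 * 2 ^+ e * o k + 1) + 1)).
  rewrite lerD2r; apply: ler_sum => k _; rewrite /K ltn_ord -[_.+1%:R]natr1 lerD2r.
  have /andP[h _] := @truncn_itv R (2 * o k * 2 ^+ e) (mulr_ge0 (mulr_ge0 (ler0n _ 2) (o0 _ (ltn_ord k))) (ltW p0)).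
  by apply: (le_trans h); rewrite mulrAC.
rewrite big_split /= -mulr_sumr sumr_const card_ord natrX.
have p1 : 1 <= 2 ^+ e :> R by apply: exprn_ege1; lra.
have : \sum_(k < 2 ^ e) o k <= V * 2 ^+ e by rewrite -ler_pdivrMr// mulrC.
rewrite -(ler_pM2l (_ : 0 < 2 * 2 ^+ e)) ?mulr_gt0//; lra.
Qed.

(** With mean oscillation V the graph needs about 2^(2e) V + 2^e sets of size 2^-e. The first term
    is about 2^(e(s + eps)), and it dominates the second because s is at least 1. *)
Lemma upper_box_le (g : R -> R) s : 1 <= s ->
  (forall eps, 0 < eps -> exists e0, forall e, (e0 <= e)%N ->
     mosc (fun x y => `|g x - g y|) e ((2 ^- e) `^ (2 - s - eps))) ->
  (upper_box_dim (graph01 g) <= s%:E)%E.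
Proof.
move=> s1 h; apply/lee_addgt0Pr => eps' eps'0; rewrite -EFinD.
pose eps := eps' / 2; have e0 : 0 < eps by rewrite /eps; lra.
have [E hE] := h _ e0.
(* The constants of the count add up to the factor c^-1, and [d < m] makes it at most d^-eps; this
   uses the second half of eps'. *)
pose c : R := 4^-1 `^ (1 + s + eps).
have c0 : 0 < c by apply: powR_gt0; lra.
pose m : R := Num.min (2 ^- E) (c `^ (1 / eps)).
have m0 : 0 < m by rewrite lt_min invr_gt0 exp2_gt0 powR_gt0.
have [mE mc] : m <= 2 ^- E /\ m <= c `^ (1 / eps) by rewrite /m !ge_min !lexx !orbT.
have m1 : m <= 1.
  apply: (le_trans mE); rewrite invf_le1 ?exp2_gt0//; apply: exprn_ege1; lra.
apply: (@le_trans _ _ (ereal_sup [set box_ratio d (graph01 g) | d in [set d : R | (0 < d < m)%R]])).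
  by apply: ereal_inf_lbound; exists m => //=; rewrite m0.
apply: ge_ereal_sup => _ [d /= /andP[d0 dm] <-].
have d01 : 0 < d < 1 by rewrite d0 (lt_le_trans dm).
have [e /andP[ed de]] := dyadic_le d01.
(* One level finer than [d], since the covering sets of [coverable_graph] have twice the diameter of
   a cell. *)
pose p : R := 2 ^- e.+1.
have p0 : 0 < p by rewrite invr_gt0 exp2_gt0.
have pE : 2 * p = 2 ^- e by rewrite /p exprS invfM mulrA mulfV ?mul1r.
have Ee : (E <= e.+1)%N.
  rewrite leqNgt; apply/negP => eE.
  have : d < 2 ^- E by apply: lt_le_trans mE.
  apply/negP; rewrite -leNgt; apply: le_trans ed; rewrite lef_pV2 ?posrE ?exp2_gt0//.
  by apply: ler_weXn2l; [lra|exact: ltnW (ltnW eE)].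
have [K [cK hK]] := coverable_graph (hE _ Ee).
have pV : p^-1 = 2 ^+ e.+1 by rewrite /p invrK.
apply: (@box_ratio_of_cover _ _ _ K) => //; first by lra.
  by apply: coverable_sub cK => //; rewrite -/p pE.
apply: (le_trans hK); rewrite -/p -pV.
have hp : p `^ (2 - s - eps) * p^-1 * p^-1 = p `^ (- (s + eps)).
  rewrite -mulrA -invfM -expr2 -powR_mulrn ?(ltW p0)// -powRN -powRD ?(gt_eqF p0) ?implybT//.
  by congr powR; lra.
have p1 : 0 < p <= 1 by rewrite p0 /=; lra.
have hq : p^-1 <= p `^ (- (s + eps)).
  by rewrite -powR_inv1 ?(ltW p0)//; apply: ger_powR => //; lra.
have hd : p `^ (- (s + eps)) <= (d / 4) `^ (- (s + eps)).
  rewrite !powRN lef_pV2 ?posrE ?powR_gt0//; last by lra.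
  by apply: ge0_ler_powR; rewrite ?nnegrE; lra.
apply: (@le_trans _ _ (4 * (d / 4) `^ (- (s + eps)))).
  move: hp => /(congr1 (fun z => 2 * z)); rewrite !mulrA; lra.
rewrite powRM ?(ltW d0)//.
have -> : d `^ (- (s + eps')) = d `^ (- (s + eps)) * d `^ (- eps).
  by rewrite -powRD ?(gt_eqF d0) ?implybT//; congr powR; rewrite /eps; lra.
rewrite mulrCA ler_pM2l ?powR_gt0//.
have -> : 4 * 4^-1 `^ (- (s + eps)) = c^-1.
  rewrite /c -powRN -{1}[4]invrK -powR_inv1 -?powRD; [|by apply/implyP => _; lra|lra].
  by congr powR; lra.
rewrite powRN lef_pV2 ?posrE ?powR_gt0//.
apply: (@le_trans _ _ ((c `^ (1 / eps)) `^ eps)).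
  by apply: ge0_ler_powR; rewrite ?nnegrE ?powR_ge0//; lra.
by rewrite -powRrM divfK ?gt_eqF// powRr1// ltW.
Qed.

End BoxDimension.

(** * The amplitudes of the waves *)

Section Amplitude.
Variable R : realType.

(** With a quadratic exponent, a shift of the index or a factor C^l changes the exponent only by
    O(l), which is negligible against l^2. *)
Definition amp (l : nat) : R := 2 ^- (l ^ 2).

Lemma amp_gt0 l : 0 < amp l. Proof. by rewrite invr_gt0 exp2_gt0. Qed.

Lemma le_exp2N (m n : nat) : (m <= n)%N -> 2 ^- n <= 2 ^- m :> R.
Proof.
move=> mn; rewrite lef_pV2 ?posrE ?exp2_gt0//; apply: ler_weXn2l => //; lra.
Qed.

Lemma exp2N_le1 n : 2 ^- n <= 1 :> R.
Proof. by have := @le_exp2N 0 n (leq0n _); rewrite expr0 invr1. Qed.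

Lemma le_amp l m : (l <= m)%N -> amp m <= amp l.
Proof. by move=> lm; apply: le_exp2N; rewrite leq_exp2r. Qed.

Lemma amp_le1 l : amp l <= 1. Proof. exact: exp2N_le1. Qed.

Lemma ampS l : amp l = 2 ^+ (2 * l + 1) * amp l.+1.
Proof.
rewrite /amp (_ : (l.+1 ^ 2 = (2 * l + 1) + l ^ 2)%N); last by ring.
by rewrite [2 ^+ (_ + l ^ 2)]exprD invfM mulrA mulfV ?mul1r// gt_eqF// exp2_gt0.
Qed.

Lemma powR2N (n : nat) (x : R) : (2 ^- n) `^ x = 2 `^ (- (n%:R * x)).
Proof.
by rewrite -powR_mulrn ?ler0n// -powRN -powRrM mulNr.
Qed.

End Amplitude.

(** * The lower bound for the Hausdorff dimension *)

Section HausdorffLowerBound.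
Variables (R : realType) (e : nat -> nat) (s : R) (g : R -> R) (kappa n0 : nat).
Variable bad : nat -> nat -> bool.
Local Notation amp := (amp R).
Local Notation amp_gt0 := (amp_gt0 R).
Local Notation exp2_gt0 := (@exp2_gt0 R).

Hypothesis e_growth : forall l, (e l + (2 * l + 3) <= e l.+1)%N.
(** In multiplicative form, the cell length 2^-(e l) raised to the power 2 - s + 1/(l+1) is at most
    [amp (l + 3)]. *)
Hypothesis e_large : forall l, ((l + 3) ^ 2)%:R <= (2 - s + l.+1%:R^-1) * (e l)%:R.
(** Summed over all levels, the bad cells have measure at most 1/2. *)
Hypothesis few_bad : forall l,
  2 ^- (e l) * (\sum_(k < 2 ^ e l) bad l k)%:R <= 2 ^- l.+2 :> R.
Hypothesis expand : forall l k x y, (n0 <= l)%N -> (k < 2 ^ e l)%N -> ~~ bad l k ->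
  in_cell (e l) k x -> in_cell (e l) k y ->
  amp l * 2 ^+ e l * `|x - y| <= 2 ^+ kappa * (`|g x - g y| + amp l.+1).
Hypothesis s_gt1 : 1 < s.
Hypothesis s_le2 : s <= 2.

Definition good (x : R) := 0 <= x < 1 /\
  forall l k, in_cell (e l) k x -> ~~ bad l k.

Lemma e_mono l m : (l <= m)%N -> (e l <= e m)%N.
Proof.
move=> /subnKC <-; elim: (m - l)%N => [|j IH]; first by rewrite addn0.
by rewrite addnS (leq_trans IH)// (leq_trans _ (e_growth _))// leq_addr.
Qed.

Lemma e_ge l : ((l.+1) ^ 2 <= e l)%N.
Proof.
elim: l => [|l IH].
  rewrite lt0n; apply/negP => /eqP e0; have := e_large 0; rewrite e0 mulr0.
  by rewrite lern0.
apply: leq_trans (e_growth l); move: IH; rewrite -!mulnn; lia.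
Qed.

(* By [expand], the part of [X] in a cell of level [l] lies in an interval whose
   length is about [amp l.+1 / amp l] times that of the cell. *)
Lemma cov_descent (X : set R) (r : R) (j l : nat) :
  (forall x, X x -> good x) -> (forall x y, X x -> X y -> `|g x - g y| <= r) ->
  r <= amp (l + j) -> (n0 <= l)%N ->
  forall k, cov (X `&` [set x | in_cell (e l) k x])
    (2 ^+ ((kappa + 3) * j) * (amp (l + j) / amp l) * 2 ^- (e l)).
Proof.
move=> Xg Xr; elim: j l => [|j IH] l hr nl k.
  rewrite muln0 expr0 addn0 mulfV ?gt_eqF ?amp_gt0// !mul1r.
  by apply: cov_sub (@cov_cell R (e l) k) => // x [].
have hr' : r <= amp (l.+1 + j) by rewrite addSnnS.
have {}IH := IH l.+1 hr' (leqW nl).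
have [-> | /set0P[z [Xz /= kz]]] := eqVneq (X `&` [set x | in_cell (e l) k x]) set0.
  by apply: cov0; rewrite !mulr_ge0 ?invr_ge0 ?(ltW (exp2_gt0 _)) ?(ltW (amp_gt0 _)).
have [/andP[_ z1] zg] := Xg _ Xz.
have k2 := in_cell_lt z1 kz; have nb := zg _ _ kz.
set L := (X in cov _ X).
set L' := 2 ^+ ((kappa + 3) * j) * (amp (l.+1 + j) / amp l.+1) * 2 ^- (e l.+1) in IH.
have [al al1] := (amp_gt0 l, amp_gt0 l.+1).
have [el el1] := (exp2_gt0 (e l), exp2_gt0 (e l.+1)).
have L'0 : 0 <= L' by rewrite !mulr_ge0 ?invr_ge0 ?(ltW (exp2_gt0 _)) ?(ltW (amp_gt0 _)).
(* The ratio of consecutive slopes. It is at least 1 by [e_growth], which allows the additive 2 in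
   the number of subcells to be absorbed. *)
pose rho := amp l.+1 * 2 ^+ e l.+1 / (amp l * 2 ^+ e l).
have rho1 : 1 <= rho.
  rewrite /rho ler_pdivlMr ?mulr_gt0// mul1r ampS mulrAC [leRHS]mulrC ler_pM2r//.
  by rewrite -exprD; apply: ler_weXn2l; [lra|rewrite addnC (leq_trans _ (e_growth l))// !leq_add2l].
(* The horizontal diameter that [expand] allows for the part of [X] in the cell, since
   [r <= amp l.+1]. *)
pose D := 2 ^+ kappa.+1 * amp l.+1 / (amp l * 2 ^+ e l).
have D0 : 0 <= D by rewrite !mulr_ge0 ?invr_ge0 ?mulr_ge0 ?(ltW (exp2_gt0 _)) ?(ltW (amp_gt0 _)).
apply: (@cov_le _ _ ((2 * D * 2 ^+ e l.+1 + 2) * L')); last first.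
  apply: cov_cells => //.
  - by move=> x [/Xg[/andP[]]].
  - move=> x y [Xx /= kx] [Xy /= ky].
    rewrite /D ler_pdivlMr ?mulr_gt0// mulrC.
    apply: (le_trans (expand nl k2 nb kx ky)); rewrite exprSr -mulrA ler_pM2l ?exp2_gt0//.
    have := Xr _ _ Xx Xy; have : amp (l.+1 + j) <= amp l.+1 by apply: le_amp; rewrite leq_addr.
    lra.
  - move=> k'; apply: (cov_sub _ (lexx _) (IH k')).
    by move=> x [[Xx _] kx]; split.
have EL : L = 2 ^+ (kappa + 3) * rho * L'.
  rewrite /L /L' /rho mulnS exprD addSnnS; field.
  by rewrite !gt_eqF.
rewrite EL ler_wpM2r//.
have -> : 2 * D * 2 ^+ e l.+1 = 2 ^+ kappa * 4 * rho.
  rewrite /D /rho exprSr; field; by rewrite !gt_eqF.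
have : 1 <= 2 ^+ kappa :> R by apply: exprn_ege1; lra.
rewrite exprD; nra.
Qed.

(* The size [r] is compared with the cell lengths [2^-(e n)] horizontally and
   with the amplitudes vertically; since [2^-(e n) <= amp n.+1], the vertical
   index [m] is larger. *)
Lemma scales (n1 : nat) (r : R) : 0 < r <= 2 ^- e n1 ->
  exists n m, [/\ (n1 <= n)%N, (n < m)%N, 2 ^- e n.+1 < r <= 2 ^- e n &
    amp m.+1 < r <= amp m].
Proof.
move=> /andP[r0 r1]; have [E hE] := half_lt r0.
have [|n [hn mn]] := @ex_minimal (fun n => 2 ^- e n < r).
  exists E; apply: hE; apply: leq_trans (e_ge E); rewrite -mulnn; clear; lia.
have [|m [hm mm]] := @ex_minimal (fun n => amp n < r).
  by exists E; apply: hE; rewrite -mulnn; case: (E) => // k; rewrite leq_pmull.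
have n1n : (n1 < n)%N.
  by rewrite ltnNge; apply/negP => /e_mono /le_exp2N -/(_ R); lra.
case: n n1n hn mn => // n n1n hn mn; rewrite ltnS in n1n.
have rn : r <= 2 ^- e n by rewrite leNgt; apply/negP => /mn; rewrite ltnn.
have ra : r <= amp n.+1 by apply: (le_trans rn); apply: le_exp2N; exact: e_ge.
case: m hm mm => [|m] hm mm.
  by move: hm; rewrite /amp exp0n// expr0 invr1 ltNge (le_trans ra)// amp_le1.
exists n, m; split=> //; last 2 first.
- by rewrite hn rn.
- by rewrite hm /= leNgt; apply/negP => /mm; rewrite ltnn.
rewrite ltnNge; apply/negP => mn'.
have : amp n.+1 <= amp m.+1 by apply: le_amp.
lra.
Qed.

(** As r exceeds 2^-(e n.+1), [X] meets at most 4 r 2^(e n.+1) cells of level [n.+1], and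
    [cov_descent] bounds the part in each. The second factor r comes from amp m = 2^(2m+1) amp m.+1
    < 2^(2m+1) r. *)
Lemma cov_slice (X : set R) (r : R) n m : (n0 <= n)%N -> (n < m)%N ->
  2 ^- e n.+1 < r -> amp m.+1 < r <= amp m ->
  (forall x, X x -> good x) -> (forall x y, X x -> X y -> `|x - y| <= r) ->
  (forall x y, X x -> X y -> `|g x - g y| <= r) ->
  cov X (2 ^+ ((kappa + 5) * m + 3) * r ^+ 2 / amp n.+1).
Proof.
move=> nn nm rn /andP[rm mr] Xg Xx Xr.
have r0 : 0 < r by apply: lt_trans rm; exact: amp_gt0.
have E : (n.+1 + (m - n.+1))%N = m by rewrite subnKC.
set j := (m - n.+1)%N in E.
have [an am] := (amp_gt0 n.+1, amp_gt0 m).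
have en := exp2_gt0 (e n.+1).
have hL k : cov (X `&` [set x | in_cell (e n.+1) k x])
    (2 ^+ ((kappa + 3) * j) * (amp m / amp n.+1) * 2 ^- (e n.+1)).
  by rewrite -E; apply: (cov_descent Xg Xr); rewrite ?E ?leqW.
apply: (cov_le _ (cov_cells (ltW r0) _ _ Xx hL)); last 2 first.
- by rewrite !mulr_ge0 ?invr_ge0 ?(ltW (exp2_gt0 _)) ?(ltW (amp_gt0 _)).
- by move=> x /Xg[/andP[]].
have hr : 2 <= 2 * r * 2 ^+ e n.+1.
  by move: rn; rewrite -div1r ltr_pdivrMr// => ?; lra.
set B := 2 ^+ ((kappa + 3) * j).
have B0 : 0 < B by exact: exp2_gt0.
apply: (@le_trans _ _ ((4 * r * 2 ^+ e n.+1) * (B * (amp m / amp n.+1) * 2 ^- e n.+1))).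
  apply: ler_wpM2r; last by lra.
  by rewrite !mulr_ge0 ?invr_ge0 ?(ltW (exp2_gt0 _)) ?(ltW (amp_gt0 _)) ?(ltW B0).
have -> : (4 * r * 2 ^+ e n.+1) * (B * (amp m / amp n.+1) * 2 ^- e n.+1)
   = (4 * r * B * amp m) / amp n.+1 by field; rewrite !gt_eqF.
rewrite ler_pM2r ?invr_gt0// ampS.
have -> : 2 ^+ ((kappa + 5) * m + 3) = 2 ^+ ((kappa + 3) * m) * 2 ^+ (2 * m + 1) * 4 :> R.
  have -> : 4 = 2 ^+ 2 :> R by ring.
  by rewrite -!exprD; congr (_ ^+ _); clear; lia.
have hB : B <= 2 ^+ ((kappa + 3) * m).
  by apply: ler_weXn2l; [lra|rewrite leq_mul2l leq_subr orbT].
set C := 2 ^+ (2 * m + 1); have C0 : 0 < C by exact: exp2_gt0.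
have h1 : C * amp m.+1 <= C * r by rewrite ler_pM2l// ltW.
have h2 : B * (C * amp m.+1) <= 2 ^+ ((kappa + 3) * m) * (C * r).
  by apply: ler_pM => //; [exact: ltW|rewrite mulr_ge0// ltW// amp_gt0].
have : 4 * r * (B * (C * amp m.+1)) <= 4 * r * (2 ^+ ((kappa + 3) * m) * (C * r)).
  by rewrite ler_pM2l// mulr_gt0.
rewrite expr2; lra.
Qed.

(** With eps = (s - t)/2, the power of 2 is at most r^-eps because r <= 2^-(m^2), and [amp n.+1] is
    at least r^(2 - s + eps) by [e_large]. The exponents add up to s - 2 eps = t. *)
Lemma slice_size (t : R) : t < s -> exists n1, (n0 <= n1)%N /\
  forall n m (r : R), (n1 <= n)%N -> (n < m)%N -> 0 < r <= 2 ^- e n -> r <= amp m ->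
  2 ^+ ((kappa + 5) * m + 3) * r ^+ 2 / amp n.+1 <= r `^ t.
Proof.
move=> ts; pose eps := (s - t) / 2; have e0 : 0 < eps by rewrite /eps; lra.
(* The first summand makes (kappa + 8) m at most eps m^2, the second makes 1/(n+1) at most eps. *)
pose N := (Num.truncn ((kappa + 8)%:R / eps) + Num.truncn eps^-1).+1.
have hN1 : (kappa + 8)%:R <= eps * N%:R.
  rewrite mulrC -ler_pdivrMr//; apply/ltW/(lt_le_trans (truncnS_gt _)).
  by rewrite ler_nat ltnS leq_addr.
have hN2 : eps^-1 <= N%:R.
  by apply/ltW/(lt_le_trans (truncnS_gt _)); rewrite ler_nat ltnS leq_addl.
exists (maxn n0 N); split; first exact: leq_maxl.
move=> n m r; rewrite geq_max => /andP[_ Nn] nm /andP[r0 rn] rm.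
have r1 : r <= 1 by apply: (le_trans rn); exact: exp2N_le1.
have hn : r `^ (2 - s + eps) <= amp n.+1.
  apply: (@le_trans _ _ ((2 ^- e n) `^ (2 - s + eps))).
    apply: ge0_ler_powR => //; rewrite ?nnegrE ?(ltW r0) ?invr_ge0 ?(ltW (exp2_gt0 _))//.
    by rewrite addr_ge0 ?subr_ge0// ltW.
  rewrite powR2N /amp -powR_mulrn ?ler0n// -powRN; apply: ler_powR; first lra.
  rewrite lerN2.
  apply: (@le_trans _ _ ((n + 3) ^ 2)%:R); first by rewrite ler_nat leq_exp2r//; clear; lia.
  apply: (le_trans (e_large n)); rewrite mulrC ler_wpM2l//.
  rewrite lerD2l -[leRHS]invrK lef_pV2 ?posrE ?invr_gt0 ?ltr0n//.
  by apply: (le_trans hN2); rewrite ler_nat leqW.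
have hm : 2 ^+ ((kappa + 5) * m + 3) <= r `^ (- eps).
  rewrite powRN -[leLHS]invrK lef_pV2 ?posrE ?invr_gt0 ?exp2_gt0 ?powR_gt0//.
  apply: (@le_trans _ _ (amp m `^ eps)).
    by apply: ge0_ler_powR => //; rewrite ?nnegrE ?(ltW (amp_gt0 _)) ?(ltW r0) ?(ltW e0).
  rewrite /amp powR2N -powR_mulrn ?ler0n// -powRN; apply: ler_powR; first lra.
  rewrite lerN2 -mulnn natrM -mulrA.
  have m1 : (0 < m)%N by case: (m) nm.
  apply: (@le_trans _ _ (m * (kappa + 8))%:R); first by rewrite ler_nat; clear -m1; nia.
  rewrite natrM ler_wpM2l//; apply: (le_trans hN1); rewrite mulrC ler_wpM2r ?(ltW e0)//.
  by rewrite ler_nat; clear -nm Nn; lia.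
have [[an p1] p2] := (amp_gt0 n.+1, @powR_gt0 _ r (2 - s + eps) r0, @powR_gt0 _ r (- eps) r0).
apply: (@le_trans _ _ (r `^ (- eps) * r ^+ 2 / r `^ (2 - s + eps))).
  apply: ler_pM.
  - by rewrite mulr_ge0 ?exprn_ge0 ?ltW// exp2_gt0.
  - by rewrite invr_ge0 ltW.
  - by rewrite ler_pM2r// exprn_gt0.
  - by rewrite lef_pV2 ?posrE.
rewrite -powR_mulrn ?(ltW r0)// -powRN -!powRD ?(gt_eqF r0) ?implybT//.
apply: ger_powR; first by rewrite r0.
by rewrite /eps; lra.
Qed.

(** Lebesgue measure on the good points is the mass: they have outer measure at least 1/2, and a
    small set of the cover captures at most its [cover_term]. *)
Lemma mass_distribution (t : R) : t < s ->
  hausdorff_measure t (graph01 g) != 0%E.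
Proof.
move=> ts; have [n1 [n01 hn1]] := slice_size ts.
suff : ((2^-1)%:E <= hausdorff_measure t (graph01 g))%E.
  move=> h; apply/eqP => E; move: h; rewrite E lee_fin; lra.
apply: (@le_trans _ _ (hausdorff_pre t (2 ^- e n1) (graph01 g))); last first.
  by apply: ereal_sup_ubound; exists (2 ^- e n1) => //=; rewrite invr_gt0 exp2_gt0.
apply: le_ereal_inf_tmp => _ [U [gU dU] <-].
pose X i : set R := [set x | good x /\ U i (x, g x)].
have hX i : exists Y, [/\ measurable Y, X i `<=` Y &
    (lebesgue_measure Y <= cover_term t (U i))%E].
  rewrite /cover_term; case: ifPn => [/eqP E|/set0P ne].
    by apply: cov_sub (cov0 (lexx 0)) => // x [_]; rewrite E.
  have [/andP[h0 hd] hdiam] := diam_ge0_le ne (dU i).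
  set r := diam (U i) in h0 hd hdiam *.
  have Xx x y : X i x -> X i y -> `|x - y| <= r.
    by move=> [_ Ux] [_ Uy]; apply: le_trans (hdiam _ _ Ux Uy); exact: (dist2_ge1 (x, g x) (y, g y)).
  have Xr x y : X i x -> X i y -> `|g x - g y| <= r.
    by move=> [_ Ux] [_ Uy]; apply: le_trans (hdiam _ _ Ux Uy); exact: (dist2_ge2 (x, g x) (y, g y)).
  (* A set of diameter 0 has no scale, but its trace is null. *)
  move: h0; rewrite le_eqVlt => /orP[/eqP r0|r0].
    apply: (cov_le _ (cov_diam Xx _)); last by rewrite -r0.
    by rewrite -r0 mulr0 powR_ge0.
  have [|n [m [nn nm hr hm]]] := @scales n1 r; first by rewrite r0.
  apply: (cov_le _ (cov_slice (leq_trans n01 nn) nm _ hm _ Xx Xr)).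
  - apply: hn1 => //; [by rewrite r0; case/andP: hr|by case/andP: hm].
  - by case/andP: hr.
  - by move=> x [].
have /choice[Y hY] := hX.
have hB l : exists B, [/\ measurable B,
   [set x : R | exists2 k, (k < 2 ^ e l)%N /\ bad l k & in_cell (e l) k x] `<=` B &
   (lebesgue_measure B <= (2^-1 / (2 ^ l.+1)%:R)%:E)%E].
  apply: (cov_sub _ _ (@cov_bigcup_mem R (2 ^ e l) (bad l)
    (fun k => [set x | in_cell (e l) k x]) (2 ^- e l) _)).
  - by move=> x [k kb kx]; exists k.
  - apply: (le_trans (few_bad l)); rewrite natrX exprS invfM.
    by rewrite lexx.
  - by move=> k _ _; exact: cov_cell.
have /choice[B hB'] := hB.
have mY i : measurable (Y i) by have [] := hY i.
have mB i : measurable (B i) by have [] := hB' i.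
(* The half-open unit interval is covered by the bad cells, of total measure at most 1/2, and the
   sets [Y i]. *)
have : (1%:E <= (2^-1)%:E + \sum_(0 <= i <oo) cover_term t (U i))%E.
  have -> : 1%:E = lebesgue_measure (`[0, 1[%classic : set R).
    by rewrite lebesgue_measure_itv /= lte01 sube0.
  apply: (@le_trans _ _ (lebesgue_measure (\bigcup_i B i `|` \bigcup_i Y i))).
    apply: le_measure; rewrite ?inE//.
      by apply: measurableU; apply: bigcupT_measurable.
    move=> x /=; rewrite in_itv /= => /andP[x0 x1].
    have [gx|ng] := pselect (forall l k, in_cell (e l) k x -> ~~ bad l k).
      right; have [|i _ Ui] := gU (x, g x).
        by exists x => //=; rewrite in_itv /= x0 ltW.
      exists i => //; have [_ + _] := hY i; apply; split => //; split => //.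
      by rewrite x0.
    have [l [k [kx bk]]] : exists l k, in_cell (e l) k x /\ bad l k.
      apply: contrapT => nex; apply: ng => l k kx; apply/negP => bk.
      by apply: nex; exists l, k.
    left; exists l => //; have [_ + _] := hB' l; apply; exists k => //.
    by split => //; exact: in_cell_lt kx.
  apply: (@le_trans _ _ (lebesgue_measure (\bigcup_i B i) + lebesgue_measure (\bigcup_i Y i))%E).
    by apply: measureU2; apply: bigcupT_measurable.
  apply: leeD.
    apply: (@le_trans _ _ (\sum_(0 <= i <oo) lebesgue_measure (B i))%E).
      by apply: measure_sigma_subadditive => //; exact: bigcupT_measurable.
    apply: le_trans (@epsilon_trick0 R (2^-1) xpredT _); last by rewrite invr_ge0.
    by apply: lee_nneseries => // l _; have [] := hB' l.
  apply: (@le_trans _ _ (\sum_(0 <= i <oo) lebesgue_measure (Y i))%E).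
    by apply: measure_sigma_subadditive => //; exact: bigcupT_measurable.
  by apply: lee_nneseries => // i _; have [] := hY i.
have : (0 <= \sum_(0 <= i <oo) cover_term t (U i))%E.
  by apply: nneseries_ge0 => i _ _; exact: cover_term_ge0.
case: (\sum_(0 <= i <oo) cover_term t (U i))%E => [S| |] //=.
  by rewrite -EFinD !lee_fin; lra.
by move=> _ _; exact: leey.
Qed.

Lemma dimH_graph_ge : (s%:E <= dimH (graph01 g))%E.
Proof.
apply: le_ereal_inf_tmp => _ [t [t0 ht] <-]; rewrite lee_fin leNgt.
by apply/negP => /mass_distribution; rewrite ht eqxx.
Qed.

End HausdorffLowerBound.

(** * The construction of the function *)

Section ScaleChoice.
(** [O e V] stands for the bound [V] on the mean oscillation at level [e]. *)
Variables (R : realType) (s : R) (O : nat -> R -> Prop).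
Hypothesis O_mono : forall e V V', V <= V' -> O e V -> O e V'.
Hypothesis O_small : forall V : R, 0 < V -> exists E, forall e, (E <= e)%N -> O e V.
Hypothesis O_dim : forall eps : R, 0 < eps ->
  exists E, forall e, (E <= e)%N -> O e ((2 ^- e) `^ (2 - s - eps)).
Hypothesis s_gt1 : 1 < s.
Hypothesis s_le2 : s <= 2.

(** The first condition makes the given subspace negligible at level [l]. The second keeps the
    scales from being too small when its functions oscillate little or there are none. *)
Let admissible l e := O e (2 ^- ((l + 3) ^ 2)) /\
  ((l + 3) ^ 2)%:R <= (2 - s + l.+1%:R^-1) * e%:R.

Let next_scale l m : exists e, (m <= e)%N /\ admissible l e /\
  forall e', (m <= e')%N -> admissible l e' -> (e <= e')%N.
Proof.
have [|e [[me Pe] hm]] := @ex_minimal (fun e => (m <= e)%N /\ admissible l e); last first.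
  by exists e; split=> //; split=> // e' me' Pe'; exact: hm.
have [E hE] := @O_small (2 ^- ((l + 3) ^ 2)) ltac:(by rewrite invr_gt0 exp2_gt0).
exists (m + E + (l + 3) ^ 2 * l.+1)%N; split; first by rewrite -addnA leq_addr.
split; first by apply: hE; rewrite -addnA addnCA leq_addr.
have l0 : 0 < l.+1%:R :> R by rewrite ltr0n.
apply: (@le_trans _ _ (l.+1%:R^-1 * (m + E + (l + 3) ^ 2 * l.+1)%:R)); last first.
  by apply: ler_wpM2r; rewrite ?ler0n// lerDr subr_ge0.
by rewrite mulrC ler_pdivlMr// -natrM ler_nat leq_addl.
Qed.

(* The last clause says that [2^-(l^2) <= 2^C * (2^-(e l))^(2 - s - eps)]. It
   comes from minimality: unless [e l] is the least scale allowed by the growth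
   condition, the scale before it violates one of the two requirements in
   [admissible]. *)
Lemma exists_scales : exists e : nat -> nat,
  [/\ forall l, (e l + (2 * l + 3) <= e l.+1)%N,
      forall l, ((l + 3) ^ 2)%:R <= (2 - s + l.+1%:R^-1) * (e l)%:R,
      forall l, O (e l) (2 ^- ((l + 3) ^ 2)) &
      forall eps : R, 0 < eps -> exists C : R, 0 <= C /\
        forall l, Num.max 0 (2 - s - eps) * (e l)%:R <= (l ^ 2)%:R + C].
Proof.
have /choice[nxt hn] : forall p : nat * nat, exists e, (p.2 <= e)%N /\ admissible p.1 e /\
  forall e', (p.2 <= e')%N -> admissible p.1 e' -> (e <= e')%N.
  by move=> [l m]; exact: next_scale.
(* Each scale is the least admissible one above the growth bound [m l]. *)
pose e := fix e l := if l is j.+1 then nxt (l, (e j + (2 * j + 3))%N) else nxt (0, 0)%N.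
pose m l := if l is j.+1 then (e j + (2 * j + 3))%N else 0%N.
have eE l : e l = nxt (l, m l) by case: l.
have [he hP hmin] : [/\ forall l, (m l <= e l)%N, forall l, admissible l (e l) &
    forall l e', (m l <= e')%N -> admissible l e' -> (e l <= e')%N].
  by split=> l; rewrite eE; have [? [? ?]] := hn (l, m l).
exists e; split; [by move=> l; exact: (he l.+1)|by move=> l; have [] := hP l
  |by move=> l; have [] := hP l|].
have emono l j : (l <= j)%N -> (e l <= e j)%N.
  move=> /subnKC <-; elim: (j - l)%N => [|i IH]; first by rewrite addn0.
  by rewrite addnS (leq_trans IH)// (leq_trans _ (he _))// leq_addr.
move=> eps e0; have [h0|h0] := leP (2 - s - eps) 0.
  by exists 0; split=> // l; rewrite mul0r addr0 ler0n.
set h : R := 2 - s - eps in h0 *.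
(* Only half of [eps] is spent on [O_dim], so that [rho = h / h'] is below 1 and rho (l+3)^2 is at
   most l^2 up to a constant. *)
pose h' : R := 2 - s - eps / 2.
have s1 := s_gt1; have s2 := s_le2.
have [h1 hh'] : h < 1 /\ h < h' by rewrite /h /h'; split; lra.
have [E hE] : exists E, forall e, (E <= e)%N -> O e ((2 ^- e) `^ h').
  by apply: O_dim; lra.
have h'0 : 0 < h' by exact: lt_trans hh'.
pose rho : R := h / h'; have rho1 : rho < 1 by rewrite /rho ltr_pdivrMr// mul1r.
have rho0 : 0 < rho by rewrite divr_gt0.
(* As h < 1, from [j0] on a minimal growth step 2j + 3 of the scale costs no more than the increase
   2j + 1 of the square. *)
pose j0 := (Num.truncn (1 - h)^-1).+1.
have hj0 j : (j0 <= j)%N -> h * (2 * j + 3)%:R <= (2 * j + 1)%:R.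
  move=> jj; have : (1 - h)^-1 <= j%:R.
    by apply/ltW/(lt_le_trans (truncnS_gt _)); rewrite ler_nat.
  rewrite -[leLHS]mul1r ler_pdivrMr ?subr_gt0//.
  have -> : (2 * j + 3)%:R = 2 * j%:R + 3 :> R by rewrite natrD natrM.
  have -> : (2 * j + 1)%:R = 2 * j%:R + 1 :> R by rewrite natrD natrM.
  lra.
(* The term 9 D comes from completing the square in (1 - rho) x^2 - 6 x. *)
pose D : R := (1 - rho)^-1.
have D0 : 0 < D by rewrite invr_gt0 subr_gt0.
have DE : D * (1 - rho) = 1 by rewrite mulVf// gt_eqF// subr_gt0.
pose C : R := h * (e j0)%:R + E%:R + 10 + 9 * D.
have he0 : 0 <= h * (e j0)%:R by rewrite mulr_ge0 ?ler0n// ltW.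
exists C; split; first by rewrite /C !addr_ge0 ?ler0n//; lra.
have E0 : 0 <= E%:R :> R by rewrite ler0n.
elim=> [|j IH].
  apply: (@le_trans _ _ (h * (e j0)%:R)); first by rewrite ler_pM2l// ler_nat emono.
  by rewrite /C mulr0n; lra.
have [jj|jj] := leqP j.+1 j0.
  apply: (@le_trans _ _ (h * (e j0)%:R)); first by rewrite ler_pM2l// ler_nat emono.
  by have := ler0n R (j.+1 ^ 2); rewrite /C; lra.
move: (he j.+1); rewrite leq_eqVlt => /orP[/eqP <-|].
  rewrite /m natrD mulrDr; apply: (le_trans (lerD IH (hj0 _ jj))).
  rewrite addrAC lerD2r -natrD ler_nat.
  by rewrite (_ : (j.+1 ^ 2 = j ^ 2 + (2 * j + 1))%N)//; ring.
case E' : (e j.+1) => [|e'] //; rewrite ltnS => me'.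
have nP : ~ admissible j.+1 e'.
  by move=> /(hmin j.+1 _ me'); rewrite E' ltnn.
(* The scale [e'] just before [e j.+1] is not admissible: either it is below the threshold of
   [O_dim], or it is too small for the amplitude. *)
have {nP} [eE'|hlt] : (e' < E)%N \/ h' * e'%:R < ((j.+1 + 3) ^ 2)%:R.
  have [|Ee] := ltnP e' E; first by left.
  right; rewrite ltNge; apply/negP => hge; apply: nP; split.
    apply: (O_mono _ (hE _ Ee)); rewrite powR2N -powR_mulrn ?ler0n// -powRN.
    by apply: ler_powR; [lra|rewrite lerN2 mulrC].
  apply: (le_trans hge); apply: ler_wpM2r; first exact: ler0n.
  have : 0 <= j.+2%:R^-1 :> R by rewrite invr_ge0 ler0n.
  rewrite /h'; move: (j.+2%:R^-1 : R) => z; lra.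
- apply: (@le_trans _ _ (1 * E%:R)).
    by apply: ler_pM; rewrite ?ler0n ?ler_nat// ltW.
  by have := ler0n R (j.+1 ^ 2); rewrite /C; lra.
- have hr : h * e'%:R <= rho * ((j.+1 + 3) ^ 2)%:R.
    have -> : h = rho * h' by rewrite /rho divfK// gt_eqF.
    by rewrite -mulrA ler_pM2l// ltW.
  rewrite -natr1 mulrDr mulr1.
  have lE : ((j.+1 + 3) ^ 2)%:R = j.+1%:R ^+ 2 + 6 * j.+1%:R + 9 :> R.
    by rewrite natrX natrD; ring.
  rewrite lE in hr; rewrite natrX.
  have l0 : 0 <= j.+1%:R :> R by rewrite ler0n.
  set x := j.+1%:R in hr l0 *.
  have sq : 0 <= D * ((1 - rho) * x - 3) ^+ 2 by rewrite mulr_ge0 ?sqr_ge0// ltW.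
  have -> : C = h * (e j0)%:R + E%:R + 10 + 9 * D by [].
  have sqE : D * ((1 - rho) * x - 3) ^+ 2 = (1 - rho) * x ^+ 2 - 6 * x + 9 * D.
    rewrite (_ : _ * _ ^+ 2 = D * (1 - rho) * (1 - rho) * x ^+ 2 - 6 * (D * (1 - rho)) * x + 9 * D).
      by rewrite DE; ring.
    by ring.
  rewrite sqE in sq.
  have : rho * x <= x by rewrite ger_pMl ?ltr0n// ltW.
  lra.
Qed.

End ScaleChoice.

(** * Modulus of continuity and expansion of the series *)

Section Takagi.
Variables (R : realType) (e : nat -> nat).
Local Notation amp := (amp R).
Let amp_gt0 l : 0 < amp l. Proof. exact: amp_gt0. Qed.
Let exp2_gt0 n : 0 < 2 ^+ n :> R. Proof. exact: exp2_gt0. Qed.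
Local Hint Resolve exp2_gt0 amp_gt0 : core.
Hypothesis e_growth : forall l, (e l + (2 * l + 3) <= e l.+1)%N.

Definition psum n (x : R) := \sum_(l < n) amp l * tri (x * 2 ^+ e l).
(* The terms are nonnegative: the supremum is the sum of the series. *)
Definition takagi (x : R) := sup [set psum n x | n in [set: nat]].

Let slope l : R := amp l * 2 ^+ e l.

Lemma amp_half n : amp n.+1 * 2 <= amp n.
Proof.
rewrite [leRHS]ampS mulrC ler_pM2r// -[leLHS]expr1.
by apply: ler_weXn2l; [lra|rewrite addn1].
Qed.

(** Amplitudes at least halve from level to level. Subtracting [2 * amp (n + j)] makes the upper
    bound inductive. *)
Lemma psum_bound n j x : psum n x <= psum (n + j) x <= psum n x + 2 * amp n - 2 * amp (n + j).
Proof.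
elim: j => [|j /andP[h1 h2]]; first by rewrite addn0; apply/andP; split; lra.
have E : psum (n + j).+1 x = psum (n + j) x + amp (n + j) * tri (x * 2 ^+ e (n + j)).
  by rewrite /psum big_ord_recr.
rewrite addnS E.
have [t0 t1] := (tri_ge0 (x * 2 ^+ e (n + j)), tri_le1 (x * 2 ^+ e (n + j))).
have a0 := amp_gt0 (n + j).
have u0 : 0 <= amp (n + j) * tri (x * 2 ^+ e (n + j)) by rewrite mulr_ge0// ltW.
have u1 : amp (n + j) * tri (x * 2 ^+ e (n + j)) <= amp (n + j) by rewrite ger_pMr.
have := amp_half (n + j).
by move=> ?; apply/andP; split; lra.
Qed.

Lemma takagi_psum n x : psum n x <= takagi x <= psum n x + 2 * amp n.
Proof.
have ub k : psum k x <= psum n x + 2 * amp n.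
  have [nk|/ltnW kn] := leqP n k.
    have /andP[_] := psum_bound n (k - n) x; rewrite subnKC// => h.
    by have := amp_gt0 k; lra.
  have /andP[+ _] := psum_bound k (n - k) x; rewrite subnKC// => h.
  by have := amp_gt0 n; lra.
apply/andP; split.
  by apply: ub_le_sup; [exists (psum n x + 2 * amp n) => _ [k _ <-]|exists n].
by apply: ge_sup; [exists (psum 0 x), 0%N|move=> _ [k _ <-]].
Qed.

Lemma slope_gt0 l : 0 < slope l. Proof. by rewrite mulr_gt0. Qed.

(** The amplitude drops by 2^(2l+1) while the frequency grows by at least 2^(2l+3); this is why
    [e_growth] has the constant 3. *)
Lemma slopeS l : 4 * slope l <= slope l.+1.
Proof.
rewrite /slope ampS [_ * amp l.+1]mulrC -mulrA mulrCA ler_pM2l// (_ : 4 = 2 ^+ 2); last by ring.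
rewrite -!exprD; apply: ler_weXn2l; first lra.
apply: leq_trans (e_growth l); clear; lia.
Qed.

Lemma sum_slope n : 3 * (\sum_(l < n) slope l) <= slope n.
Proof.
elim: n => [|n IH]; first by rewrite big_ord0 mulr0 ltW// slope_gt0.
by rewrite big_ord_recr /=; have := slopeS n; lra.
Qed.

Lemma psum_lip n x y : `|psum n x - psum n y| <= (\sum_(l < n) slope l) * `|x - y|.
Proof.
rewrite /psum -sumrB mulr_suml; apply: (le_trans (ler_norm_sum _ _ _)).
apply: ler_sum => l _; rewrite -mulrBr normrM (gtr0_norm (amp_gt0 _)) /slope -mulrA.
rewrite ler_pM2l//; apply: (le_trans (tri_lip _ _)).
by rewrite -mulrBl normrM (gtr0_norm (exp2_gt0 _)) mulrC.
Qed.

(** The waves up to level [n] have total slope below [2 * slope n], and the tail is at most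
    [2 * amp n.+1]. *)
Lemma takagi_modulus n x y :
  `|takagi x - takagi y| <= 2 * slope n * `|x - y| + 2 * amp n.+1.
Proof.
have /andP[a b] := takagi_psum n.+1 x; have /andP[c d] := takagi_psum n.+1 y.
have h : (\sum_(l < n.+1) slope l) * `|x - y| <= 2 * slope n * `|x - y|.
  apply: ler_wpM2r => //; rewrite big_ord_recr /=.
  by have := sum_slope n; have := slope_gt0 n; lra.
have := le_trans (psum_lip n.+1 x y) h; rewrite !ler_norml => /andP[? ?].
by apply/andP; split; lra.
Qed.

(** On a cell the wave of level [l] is affine; the earlier ones together have at most a third of its
    slope, and the later ones enter as the error. *)
Lemma takagi_expand l k x y : in_cell (e l) k x -> in_cell (e l) k y ->
  slope l * `|x - y| <= 2 * `|takagi x - takagi y| + 4 * amp l.+1.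
Proof.
move=> kx ky.
have /andP[a b] := takagi_psum l.+1 x; have /andP[c d] := takagi_psum l.+1 y.
have E : amp l * `|tri (x * 2 ^+ e l) - tri (y * 2 ^+ e l)| = slope l * `|x - y|.
  by rewrite (tri_cell kx ky) -mulrBl normrM (gtr0_norm (exp2_gt0 _)) mulrA mulrAC.
have F : psum l.+1 x - psum l.+1 y = (psum l x - psum l y) +
    amp l * (tri (x * 2 ^+ e l) - tri (y * 2 ^+ e l)).
  by rewrite /psum !big_ord_recr /=; ring.
have h : (\sum_(l < l) slope l) * `|x - y| <= 3^-1 * slope l * `|x - y|.
  by apply: ler_wpM2r => //; have := sum_slope l; lra.
have h2 := le_trans (psum_lip l x y) h.
rewrite -(gtr0_norm (amp_gt0 l)) -normrM in E.
have : slope l * `|x - y| <= `|psum l.+1 x - psum l.+1 y| + `|psum l x - psum l y|.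
  rewrite -E (_ : _ * (_ - _) = (psum l.+1 x - psum l.+1 y) - (psum l x - psum l y)).
    exact: ler_normB.
  by rewrite F addrAC subrr add0r.
have : `|psum l.+1 x - psum l.+1 y| <= `|takagi x - takagi y| + 2 * amp l.+1.
  by have := ler_norm (takagi x - takagi y); have := ler_norm (- (takagi x - takagi y));
    rewrite normrN ler_norml => ? ?; apply/andP; split; lra.
have := normr_ge0 (takagi x - takagi y); have := amp_gt0 l.+1; lra.
Qed.

Lemma amp_small (x : R) : 0 < x -> exists n0, forall n, (n0 <= n)%N -> amp n < x.
Proof.
move=> /half_lt[n0 h]; exists n0 => n nn; apply: h.
by rewrite -mulnn; case: n nn => [|n] nn //; apply: (leq_trans nn); rewrite leq_pmull.
Qed.

Lemma takagi_continuous : continuous takagi.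
Proof.
move=> x; apply/cvgrPdist_lt => eps eps0.
have [n hn] : exists n, amp n < eps / 4 by have [n h] := @amp_small (eps / 4) ltac:(lra); exists n; apply: h.
have an : amp n.+1 < eps / 4 by apply: le_lt_trans hn; exact: le_amp.
have d0 : 0 < eps / (4 * slope n) by rewrite divr_gt0// mulr_gt0// slope_gt0.
near=> y; apply: (le_lt_trans (takagi_modulus n x y)).
have : `|x - y| < eps / (4 * slope n) by near: y; exact: cvgr_dist_lt.
rewrite ltr_pdivlMr ?mulr_gt0 ?slope_gt0//; lra.
Unshelve. all: by end_near. Qed.

(** For e n <= i < e n.+1 and points at distance 2^-i, both terms of the modulus are O(2^-(i h)), by
    the bound on the scales at [n] and at [n.+1] respectively. *)
Lemma takagi_osc (s : R) : 1 < s ->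
  (forall eps : R, 0 < eps -> exists C : R, 0 <= C /\
     forall l, Num.max 0 (2 - s - eps) * (e l)%:R <= (l ^ 2)%:R + C) ->
  forall eps : R, 0 < eps -> exists E, forall i, (E <= i)%N ->
    mosc (fun x y => `|takagi x - takagi y|) i ((2 ^- i) `^ (2 - s - eps)).
Proof.
move=> s1 hC eps e0; have e20 : 0 < eps / 2 by lra.
have [C [C0 {}hC]] := hC _ e20.
(* The exponent must lie in [0,1]: [h >= 0] is used in [A1] for monotonicity, [h <= 1] in [A2]. *)
set h : R := Num.max 0 (2 - s - eps / 2) in hC.
have [h0 hge] : 0 <= h /\ 2 - s - eps / 2 <= h by rewrite !le_max !lexx !orbT.
have h1 : h <= 1 by rewrite ge_max ler01 /=; lra.
(* From level [N] on, the factor 2^(C + 2) is absorbed by half of [eps]. *)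
pose N := (Num.truncn ((C + 2) / (eps / 2))).+1.
have hN : (C + 2) <= N%:R * (eps / 2).
  by rewrite -ler_pdivrMr//; exact/ltW/truncnS_gt.
exists (maxn N (e 0)) => i; rewrite geq_max => /andP[Ni ei].
have emono j : (j <= e j)%N.
  elim: j => // j IH; apply: leq_trans (e_growth j); move: IH; clear; lia.
have [|n [hn hmin]] := @ex_minimal (fun n => (i < e n)%N).
  by exists i.+1; exact: emono.
case: n hn hmin => [|n] hn hmin; first by move: hn; rewrite ltnNge ei.
have eni : (e n <= i)%N by rewrite leqNgt; apply/negP => /hmin; rewrite ltnn.
have hamp l : amp l <= 2 `^ C * (2 ^- e l) `^ h.
  rewrite powR2N -powRD ?pnatr_eq0 ?implybT// /amp -powR_mulrn ?ler0n// -powRN.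
  apply: ler_powR; first lra.
  by have := hC l; rewrite mulrC; lra.
have p2C : 0 < 2 `^ C :> R by exact: powR_gt0.
have absorb : 4 * 2 `^ C * (2 ^- i) `^ h <= (2 ^- i) `^ (2 - s - eps).
  have -> : 4 = 2 `^ 2 :> R by rewrite powR_mulrn//; ring.
  rewrite !powR2N -!powRD ?pnatr_eq0 ?implybT//; apply: ler_powR; first lra.
  have i0 : 0 <= i%:R :> R by exact: ler0n.
  have Ni' : N%:R * (eps / 2) <= i%:R * (eps / 2) by rewrite ler_pM2r// ler_nat.
  have : i%:R * (2 - s - eps / 2) <= i%:R * h by rewrite ler_wpM2l.
  lra.
apply: mosc_const => k x y k2 kx ky; apply: le_trans absorb.
have xy : `|x - y| <= 2 ^- i.
  by rewrite -[leRHS]mul1r ler_pdivlMr//; exact: in_cell_dist kx ky.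
apply: (le_trans (takagi_modulus n x y)).
have A1 : amp n.+1 <= 2 `^ C * (2 ^- i) `^ h.
  apply: (le_trans (hamp _)); rewrite ler_pM2l//; apply: ge0_ler_powR => //.
  - by rewrite nnegrE invr_ge0 ltW.
  - by rewrite nnegrE invr_ge0 ltW.
  - by apply: le_exp2N; exact: ltnW.
have A2 : slope n * 2 ^- i <= 2 `^ C * (2 ^- i) `^ h.
  have Ei : 2 ^- i = 2 ^- (i - e n) * 2 ^- e n :> R.
    by rewrite -invfM -exprD subnK.
  have -> : slope n * 2 ^- i = amp n * 2 ^- (i - e n).
    rewrite Ei /slope; field; by rewrite !gt_eqF.
  rewrite Ei [X in _ <= _ * X]powRM ?invr_ge0 ?(ltW (exp2_gt0 _))//.
  rewrite mulrA mulrAC; apply: ler_pM => //; first exact: ltW.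
  by apply: ger1_powR => //; rewrite invr_gt0 exp2_gt0 exp2N_le1.
have A3 : slope n * `|x - y| <= slope n * 2 ^- i by rewrite ler_pM2l// slope_gt0.
lra.
Qed.

End Takagi.

(** * Extending a subspace *)

Section Extension.
Variable R : realType.
Local Notation amp := (amp R).
Local Notation amp_gt0 := (amp_gt0 R).
Local Notation exp2_gt0 := (@exp2_gt0 R).

(** Uniform continuity by compactness of [0,1] in its near-covering form, over the filter of small
    positive [d]. *)
Lemma C01_modulus (g : R -> R) (V : R) : C01 g -> 0 < V -> exists2 d : R, 0 < d &
  forall x y, 0 <= x <= 1 -> 0 <= y <= 1 -> `|x - y| < d -> `|g x - g y| <= V.
Proof.
move=> cg V0.
pose P (d x : R) := 0 <= x <= 1 -> forall y, 0 <= y <= 1 -> `|x - y| < d -> `|g x - g y| <= V.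
have : compact `[0 : R, 1]%classic by exact: segment_compact.
move=> /compact_near_coveringP /(_ R (0^'+) P _).
case.
  move=> x /=; rewrite in_itv /= => x01.
  have /subspace_continuousP/(_ x) cx := cg.
  have {}cx : g y @[y --> within `[0, 1]%classic (nbhs x)] --> g x.
    by apply: cx; rewrite /= in_itv.
  have V2 : 0 < V / 2 by lra.
  move: cx => /cvgrPdist_lt /(_ _ V2) /nbhs_ballP[r /= r0 hr].
  have hr' y : 0 <= y <= 1 -> `|x - y| < r -> `|g x - g y| < V / 2.
    by move=> y01 xy; apply: (hr y xy); rewrite /= in_itv.
  exists (ball x (r / 2), [set d : R | d < r / 2]); first split => /=.
  - by apply: nbhsx_ballx; lra.
  - by apply: nbhs_right_lt; lra.
  move=> [z d] /= [xz dr] z01 y y01 zy.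
  have xz' : `|x - z| < r / 2 by exact: xz.
  have xy : `|x - y| < r.
    by rewrite -(subrK z x) -addrA; apply: (le_lt_trans (ler_normD _ _)); lra.
  have h1 : `|x - z| < r by lra.
  have := hr' _ z01 h1; have := hr' _ y01 xy.
  have -> : g z - g y = (g x - g y) - (g x - g z) by ring.
  by move=> ? ?; apply: (le_trans (ler_normB _ _)); lra.
move=> d /= d0 hd; exists (d / 2); first by move: d0 => /= ?; lra.
move=> x y x01 y01 xy.
move: d0 => /= d0; apply: (hd (d / 2)) => //=; last by lra.
by rewrite sub0r normrN gtr0_norm; lra.
Qed.

Lemma mosc_small (g : R -> R) (V : R) : C01 g -> 0 < V ->
  exists E, forall e, (E <= e)%N -> mosc (fun x y => `|g x - g y|) e V.
Proof.
move=> cg V0; have [d d0 hd] := C01_modulus cg V0.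
have [E hE] := half_lt d0; exists E => e Ee.
apply: mosc_const => k x y k2 kx ky.
have /andP[x0 x1] := cell_in01 k2 kx; have /andP[y0 y1] := cell_in01 k2 ky.
apply: hd; rewrite ?x0 ?y0 ?ltW//; apply: le_lt_trans (hE _ Ee).
by rewrite -[leRHS]mul1r ler_pdivlMr ?exp2_gt0//; exact: in_cell_dist kx ky.
Qed.

Lemma absorb_const (M a eps : R) : 0 < eps -> exists E, forall e, (E <= e)%N ->
  M * (2 ^- e) `^ a <= (2 ^- e) `^ (a - eps).
Proof.
move=> e0; pose A := Num.max 1 M; have A1 : 1 <= A by rewrite le_max lexx.
have MA : M <= A by rewrite le_max lexx orbT.
have A0 : 0 < A by lra.
have [E hE] := @half_lt R (A^-1 `^ (1 / eps)) ltac:(by apply: powR_gt0; rewrite invr_gt0).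
exists E => e /hE h; have p0 : 0 < 2 ^- e :> R by rewrite invr_gt0 exp2_gt0.
rewrite powRD ?(gt_eqF p0) ?implybT// mulrC ler_pM2l ?powR_gt0//.
apply: (le_trans MA); rewrite powRN -[leLHS]invrK lef_pV2 ?posrE ?invr_gt0 ?powR_gt0//.
apply: (@le_trans _ _ ((A^-1 `^ (1 / eps)) `^ eps)).
  by apply: ge0_ler_powR; rewrite ?nnegrE ?powR_ge0 ?(ltW p0) ?(ltW e0) ?(ltW h).
by rewrite -powRrM divfK ?gt_eqF// powRr1// invr_ge0 ltW.
Qed.

(** A cover by K <= 2^(e(s + eps/2)) sets gives mean oscillation at most 6 K 2^(-2e); the constant 6
    costs the other half of [eps]. *)
Lemma mosc_of_upper_box (g : R -> R) (s eps : R) : C01 g ->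
  upper_box_dim (graph01 g) = s%:E -> 0 < eps -> exists E, forall e, (E <= e)%N ->
    mosc (fun x y => `|g x - g y|) e ((2 ^- e) `^ (2 - s - eps)).
Proof.
move=> cg hs e0; have e20 : 0 < eps / 2 by lra.
have [d0 [/andP[d00 _] hd]] := upper_box_cover hs e20.
have [E1 hE1] := half_lt d00.
have [E2 hE2] := @absorb_const 6 (2 - s - eps / 2) (eps / 2) e20.
exists (maxn E1 E2) => e; rewrite geq_max => /andP[Ee1 Ee2].
have p0 : 0 < 2 ^- e :> R by rewrite invr_gt0 exp2_gt0.
have [|K [[U [gU dU]] hK]] := hd (2 ^- e); first by rewrite p0 hE1.
apply: mosc_sub (mosc_of_cover cg gU dU) => //.
have -> : 2 - s - eps = 2 - s - eps / 2 - eps / 2 by lra.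
apply: le_trans (hE2 _ Ee2).
have -> : 2 - s - eps / 2 = - (s + eps / 2) + 2 by ring.
rewrite powRD ?(gt_eqF p0) ?implybT// (powR_mulrn 2 (ltW p0)) expr2 -mulrA.
by rewrite ler_pM2l// ler_pM2r// mulr_gt0.
Qed.

(** Dominates the oscillation of every combination up to the factor [\sum_i |c i|], so that one
    choice of scales serves the whole span. *)
Definition dist_family k (w : 'I_k -> R -> R) (x y : R) : R :=
  \sum_(i < k) `|w i x - w i y|.

Lemma eventually_all k (P : 'I_k -> nat -> Prop) :
  (forall i, exists E, forall e, (E <= e)%N -> P i e) ->
  exists E, forall e, (E <= e)%N -> forall i, P i e.
Proof.
move=> /choice[E hE]; exists (\max_(i < k) E i) => e Ee i; apply: hE.
exact: leq_trans (leq_bigmax _) Ee.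
Qed.

Lemma C01_lincomb k (c : 'I_k -> R) (w : 'I_k -> R -> R) :
  (forall i, C01 (w i)) -> C01 (lincomb c w).
Proof.
move=> cw; apply/subspace_continuousP => x x01.
suff : forall r : seq 'I_k, (fun y => \sum_(i <- r) c i * w i y) y
    @[y --> within `[0, 1]%classic (nbhs x)] --> \sum_(i <- r) c i * w i x by exact.
elim=> [|i r IH].
  rewrite big_nil (_ : (fun _ => _) = cst 0); first exact: cvg_cst.
  by apply/funext => y; rewrite big_nil.
rewrite big_cons (_ : (fun _ => _) = fun y => c i * w i y + \sum_(j <- r) c j * w j y).
  apply: cvgD => //; apply: cvgM; first exact: cvg_cst.
  by have /subspace_continuousP/(_ x x01) := cw i.
by apply/funext => y; rewrite big_cons.
Qed.

(** As s > 1, this separates members of [HB_set s] from zero and yields linear independence. *)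
Lemma zero_box_le1 (g : R -> R) : is_zero01 g -> (upper_box_dim (graph01 g) <= 1%:E)%E.
Proof.
move=> g0; apply: upper_box_le => // eps _; exists 0%N => e _.
apply: mosc_const => k x y k2 kx ky.
have /andP[x0 x1] := cell_in01 k2 kx; have /andP[y0 y1] := cell_in01 k2 ky.
by rewrite !g0 ?subrr ?normr0 ?powR_ge0 ?x0 ?y0 ?ltW.
Qed.

Lemma lincomb_diff k (c : 'I_k -> R) (w : 'I_k -> R -> R) x y :
  `|lincomb c w x - lincomb c w y| <= (\sum_(i < k) `|c i|) * dist_family w x y.
Proof.
rewrite /lincomb -sumrB mulr_suml; apply: (le_trans (ler_norm_sum _ _ _)).
apply: ler_sum => i _; rewrite -mulrBr normrM ler_wpM2l//.
by rewrite /dist_family (bigD1 i)//= lerDl sumr_ge0.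
Qed.

(** * Dimensions of a combination involving the new function *)

Section Perturbation.
Variables (s : R) (k : nat) (w : 'I_k -> R -> R) (e : nat -> nat).
Hypothesis s_gt1 : 1 < s.
Hypothesis s_le2 : s <= 2.
Hypothesis cw : forall i, C01 (w i).
Hypothesis w_dim : forall eps : R, 0 < eps -> exists E, forall i, (E <= i)%N ->
  mosc (dist_family w) i ((2 ^- i) `^ (2 - s - eps)).
Hypothesis e_growth : forall l, (e l + (2 * l + 3) <= e l.+1)%N.
Hypothesis e_large : forall l, ((l + 3) ^ 2)%:R <= (2 - s + l.+1%:R^-1) * (e l)%:R.
Hypothesis w_small : forall l, mosc (dist_family w) (e l) (2 ^- ((l + 3) ^ 2)).
Hypothesis e_small : forall eps : R, 0 < eps -> exists C : R, 0 <= C /\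
  forall l, Num.max 0 (2 - s - eps) * (e l)%:R <= (l ^ 2)%:R + C.
Variables (a : R) (c : 'I_k -> R).
Hypothesis a0 : a != 0.
Let g x := a * takagi e x + lincomb c w x.
Let M : R := \sum_(i < k) `|c i|.

Lemma coeff_norm_ge0 : 0 <= M. Proof. exact: sumr_ge0. Qed.

Lemma dist_family_ge0 x y : 0 <= dist_family w x y.
Proof. exact: sumr_ge0. Qed.

Lemma perturb_C01 : C01 g.
Proof.
apply/subspace_continuousP => x x01; apply: cvgD.
  apply: cvgM; first exact: cvg_cst.
  by apply: cvg_within_filter; exact: takagi_continuous.
by have /subspace_continuousP/(_ x x01) := C01_lincomb (c := c) cw.
Qed.

Lemma perturb_upper : (upper_box_dim (graph01 g) <= s%:E)%E.
Proof.
apply: upper_box_le; first exact: ltW.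
move=> eps e0; have e20 : 0 < eps / 2 by lra.
have [E1 hE1] := takagi_osc e_growth s_gt1 e_small e20.
have [E2 hE2] := w_dim e20.
have [E3 hE3] := @absorb_const (`|a| + M) (2 - s - eps / 2) (eps / 2) e20.
exists (maxn E1 (maxn E2 E3)) => i; rewrite !geq_max => /and3P[/hE1 h1 /hE2 h2 /hE3 h3].
have := mosc_add (mosc_scale (normr_ge0 a) h1) (mosc_scale coeff_norm_ge0 h2).
apply: mosc_sub => [x y _ _|].
  have -> : g x - g y = a * (takagi e x - takagi e y) + (lincomb c w x - lincomb c w y).
    by rewrite /g; ring.
  apply: (le_trans (ler_normD _ _)); rewrite normrM lerD2l; exact: lincomb_diff.
rewrite -mulrDl; apply: (le_trans h3).
by rewrite (_ : 2 - s - eps / 2 - eps / 2 = 2 - s - eps)//; lra.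
Qed.

Lemma perturb_lower : (s%:E <= dimH (graph01 g))%E.
Proof.
have /choice[ osc ho] := w_small.
(* By Markov's inequality the bad cells have proportion at most amp (l+3) / amp (l+2) =
   2^-(2l+5). *)
pose bad l j := ~~ (osc l j <= amp l.+2).
have pa : 0 < `|a| by rewrite normr_gt0.
(* [k1] accounts for the division by [|a|], and from level [n0] on the part in the span is at most
   [|a| * amp l.+1] on cells that are not bad. *)
have [k1 hk1] := half_lt pa.
have pM : 0 < `|a| / (M + 1) by rewrite divr_gt0//; have := coeff_norm_ge0; lra.
have [n0 hn0] := half_lt pM.
apply: (@dimH_graph_ge R e s g (k1 + 3) n0 bad) => //.
- move=> l; have [hl1 hl2] := ho l.
  have o0 j : (j < 2 ^ e l)%N -> 0 <= osc l j.
    move=> j2; have jx : in_cell (e l) j (j%:R / 2 ^+ e l : R).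
      by rewrite /in_cell divfK ?gt_eqF ?exp2_gt0// lexx ltr_nat /=.
    exact: le_trans (dist_family_ge0 _ _) (hl1 j _ _ j2 jx jx).
  have al := amp_gt0 l.+2.
  apply: (@le_trans _ _ (2 ^- ((l + 3) ^ 2) / amp l.+2)).
    rewrite ler_pdivlMr// -mulrA; apply: le_trans hl2.
    rewrite ler_pM2l ?invr_gt0 ?exp2_gt0// natr_sum mulr_suml; apply: ler_sum => j _.
    rewrite /bad -ltNge; case: ltP => h; first by rewrite mul1r ltW.
    by rewrite mul0r o0.
  rewrite /amp (_ : (l + 3 = l.+3)%N); last by rewrite addn3.
  rewrite -/(amp l.+3) ler_pdivrMr ?invr_gt0 ?exp2_gt0// -/(amp l.+2) (ampS _ l.+2).
  rewrite mulrA -[leLHS]mul1r ler_pM2r ?amp_gt0// -ler_pdivrMl ?invr_gt0 ?exp2_gt0//.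
  by rewrite invrK mulr1; apply: ler_weXn2l; [lra|clear; lia].
- move=> l j x y nl j2; rewrite negbK => nb jx jy.
  have [hl1 _] := ho l; have al := amp_gt0 l.+1.
  have hw : `|lincomb c w x - lincomb c w y| <= `|a| * amp l.+1.
    apply: (le_trans (lincomb_diff c w x y)).
    have hd : dist_family w x y <= amp l.+2 by apply: le_trans nb; exact: (hl1 j).
    have M0 := coeff_norm_ge0.
    apply: (@le_trans _ _ (M * amp l.+2)); first by rewrite ler_wpM2l.
    rewrite (ampS _ l.+1) mulrA ler_pM2r ?amp_gt0//.
    have : 2 ^- (2 * l.+1 + 1) < `|a| / (M + 1).
      by apply: hn0; apply: (leq_trans nl); clear; lia.
    rewrite ltr_pdivlMr; last by lra.
    rewrite mulrC ltr_pdivrMr ?exp2_gt0// => h; lra.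
  have hf : `|a| * `|takagi e x - takagi e y| <= `|g x - g y| + `|a| * amp l.+1.
    rewrite -normrM (_ : a * _ = (g x - g y) - (lincomb c w x - lincomb c w y)); last first.
      by rewrite /g; ring.
    by apply: (le_trans (ler_normB _ _)); rewrite lerD2l.
  apply: (le_trans (takagi_expand e_growth jx jy)).
  have := hk1 _ (leqnn _); rewrite -div1r ltr_pdivrMr ?exp2_gt0// mulrC => h1.
  set T := `|takagi e x - takagi e y| in hf *; set G := `|g x - g y| in hf *.
  have T0 : 0 <= T by exact: normr_ge0.
  have G0 : 0 <= G by exact: normr_ge0.
  set K : R := 2 ^+ k1 in h1 *.
  have K1 : 1 <= K by apply: exprn_ege1; lra.
  rewrite exprD -/K.
  have : T <= K * G + amp l.+1.
    rewrite -(ler_pM2l pa); apply: (le_trans hf).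
    rewrite mulrDr lerD2r mulrA mulrC -[leLHS]mulr1 ler_wpM2l// mulrC; lra.
  have : amp l.+1 <= K * amp l.+1 by rewrite ler_peMl// ltW.
  have : 0 <= K * G by rewrite mulr_ge0//; lra.
  rewrite (_ : 2 ^+ 3 = 8 :> R); last by ring.
  move=> *; rewrite mulrDr ![_ * 8 * _]mulrAC; lra.
Qed.

Lemma perturb_HB : HB_set s g.
Proof.
have s0 : 0 <= s by have := s_gt1; lra.
have hD : (dimH (graph01 g) <= lower_box_dim (graph01 g))%E.
  have hl : (lower_box_dim (graph01 g) <= s%:E)%E.
    exact: le_trans (lower_le_upper_box _) perturb_upper.
  (* [dimH_le_lower_box] takes a nonnegative real bound; negative and infinite values are excluded
     by the lower bound s > 1 on [dimH]. *)
  case E : (lower_box_dim (graph01 g)) hl => [r| |] //= hl.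
  - have [r0|r0] := leP 0 r; first by apply: dimH_le_lower_box => //; rewrite E.
    have h0 : (dimH (graph01 g) <= 0%:E)%E.
      by apply: dimH_le_lower_box => //; rewrite E lee_fin ltW.
    by move: (le_trans perturb_lower h0); rewrite lee_fin leNgt (lt_trans ltr01 s_gt1).
  - have h0 : (dimH (graph01 g) <= 0%:E)%E.
      by apply: dimH_le_lower_box => //; rewrite E leNye.
    by move: (le_trans perturb_lower h0); rewrite lee_fin leNgt (lt_trans ltr01 s_gt1).
have hL := lower_le_upper_box (graph01 g).
have hU := perturb_upper; have hH := perturb_lower.
split; first exact: perturb_C01.
split; [|split]; apply/eqP; rewrite eq_le; apply/andP; split => //.
- exact: le_trans hD (le_trans hL hU).
- exact: le_trans hL hU.
- exact: le_trans hH hD.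
- exact: le_trans hH (le_trans hD hL).
Qed.

End Perturbation.

Lemma exists_perturbation s k (w : 'I_k -> R -> R) : 1 < s -> s <= 2 ->
  (forall i, C01 (w i)) -> (forall i, upper_box_dim (graph01 (w i)) = s%:E) ->
  exists f, forall (a : R) (c : 'I_k -> R), a != 0 ->
    HB_set s (fun x => a * f x + lincomb c w x).
Proof.
move=> s1 s2 cw ws.
have w_dim : forall eps : R, 0 < eps -> exists E, forall i, (E <= i)%N ->
    mosc (dist_family w) i ((2 ^- i) `^ (2 - s - eps)).
  move=> eps e0; have e20 : 0 < eps / 2 by lra.
  have [E1 hE1] := eventually_all (fun i => mosc_of_upper_box (cw i) (ws i) e20).
  have [E2 hE2] := @absorb_const k%:R (2 - s - eps / 2) (eps / 2) e20.
  exists (maxn E1 E2) => i; rewrite geq_max => /andP[/hE1 h1 /hE2 h2].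
  apply: mosc_sub (mosc_sum h1) => //; apply: (le_trans h2).
  by rewrite (_ : 2 - s - eps / 2 - eps / 2 = 2 - s - eps)//; lra.
have w_small : forall V : R, 0 < V -> exists E, forall e, (E <= e)%N ->
    mosc (dist_family w) e V.
  (* Dividing by [k.+1] also covers the empty family. *)
  move=> V V0; have V'0 : 0 < V / k.+1%:R by rewrite divr_gt0 ?ltr0n.
  have [E hE] := eventually_all (fun i => mosc_small (cw i) V'0).
  exists E => e /hE h; apply: mosc_sub (mosc_sum h) => //.
  by rewrite mulrCA ger_pMr// ler_pdivrMr ?ltr0n// mul1r ler_nat.
have [e [h1 h2 h3 h4]] := @exists_scales R s (mosc (dist_family w))
  (fun e V V' VV' => mosc_sub (fun x y _ _ => lexx _) VV') w_small w_dim s1 s2.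
by exists (takagi e) => a c a0; exact: perturb_HB.
Qed.

Lemma lincomb_recl k (c : 'I_k.+1 -> R) (v : 'I_k.+1 -> R -> R) :
  lincomb c v = fun x => c ord0 * v ord0 x +
    lincomb (fun i => c (lift ord0 i)) (fun i => v (lift ord0 i)) x.
Proof. by apply/funext => x; rewrite /lincomb big_ord_recl. Qed.

(** A combination with nonzero coefficient at the new function is in [HB_set s] by the perturbation
    result; the others are combinations of [w]. *)
Lemma extend_subspace s k (w : 'I_k -> R -> R) : 1 < s -> s <= 2 ->
  subspace_in (HB_set s) w -> exists v : 'I_k.+1 -> R -> R,
    subspace_in (HB_set s) v /\ forall i, v (lift ord0 i) = w i.
Proof.
move=> s1 s2 [cw [iw aw]].
have lin1 i : lincomb (fun j => (j == i)%:R) w = w i.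
  apply/funext => x; rewrite /lincomb (bigD1 i)//= eqxx mul1r big1 ?addr0// => j ji.
  by rewrite (negbTE ji) mul0r.
have ws i : upper_box_dim (graph01 (w i)) = s%:E.
  have [[_ [_ [_]]]|z] := aw (fun j => (j == i)%:R); first by rewrite lin1.
  by have /eqP := iw _ z i; rewrite eqxx oner_eq0.
have [f hf] := exists_perturbation s1 s2 cw ws.
pose v (j : 'I_k.+1) := if unlift ord0 j is Some i then w i else f.
have v0 : v ord0 = f by rewrite /v unlift_none.
have vl : (fun i => v (lift ord0 i)) = w by apply/funext => i; rewrite /v liftK.
have vE (c : 'I_k.+1 -> R) :
    lincomb c v = fun x => c ord0 * f x + lincomb (fun i => c (lift ord0 i)) w x.
  by rewrite lincomb_recl v0 vl.
have hv (c : 'I_k.+1 -> R) : c ord0 != 0 -> HB_set s (lincomb c v).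
  by move=> c0; rewrite vE; exact: hf.
have vE0 (c : 'I_k.+1 -> R) : c ord0 = 0 ->
    lincomb c v = lincomb (fun i => c (lift ord0 i)) w.
  by move=> c0; rewrite vE c0; apply/funext => x; rewrite mul0r add0r.
exists v; split; last by move=> i; rewrite -[in RHS]vl.
split.
  move=> j; rewrite /v; case: unliftP => [i _|_]; first exact: cw.
  (* The new function is itself the perturbation with a = 1 and zero coefficients. *)
  have := (hf 1 (fun=> 0) (oner_neq0 _)).1.
  by congr C01; apply/funext => x; rewrite mul1r /lincomb big1 ?addr0// => i _; rewrite mul0r.
split=> c.
  have [c0|c0] := eqVneq (c ord0) 0.
    move=> z j; case: (unliftP ord0 j) => [i ->|-> //].
    by apply: (iw (fun i => c (lift ord0 i))); rewrite -vE0.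
  move=> /zero_box_le1; have [_ [_ [_ ->]]] := hv _ c0.
  by rewrite lee_fin leNgt s1.
have [c0|c0] := eqVneq (c ord0) 0; first by rewrite vE0.
by left; exact: hv.
Qed.

Lemma extend_subspace_many s n m (w : 'I_n -> R -> R) : 1 < s -> s <= 2 ->
  subspace_in (HB_set s) w -> exists v : 'I_(n + m) -> R -> R,
    subspace_in (HB_set s) v /\ forall i, exists j, v j = w i.
Proof.
move=> s1 s2 hw; elim: m => [|m [v [hv vw]]].
  by rewrite addn0; exists w; split=> // i; exists i.
rewrite addnS; have [u [hu uv]] := extend_subspace s1 s2 hv.
by exists u; split=> // i; have [j <-] := vw i; exists (lift ord0 j).
Qed.

End Extension.

Theorem theorem4p4 (R : realType) (s : R) (n m : nat) :
  1 < s <= 2 -> (0 < n)%N -> (0 < m)%N ->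
  lineable_pair (HB_set s) n m.
Proof.
move=> /andP[s1 s2] _ _; split.
  (* Lineability is the extension of the zero subspace by [n] dimensions. *)
  have w0 : subspace_in (HB_set s) (fun (_ : 'I_0) (_ : R) => 0).
    split; [by case|split=> [c _ []//|c]]; right => x _.
    by rewrite /lincomb big_ord0.
  by have [v [hv _]] := extend_subspace_many n s1 s2 w0; exists v.
move=> w hw; have [v [hv vw]] := extend_subspace_many m s1 s2 hw.
exists v; split=> // i; have [j <-] := vw i.
exists (fun l => (l == j)%:R) => x _; rewrite /lincomb (bigD1 j)//= eqxx mul1r.
by rewrite big1 ?addr0// => l lj; rewrite (negbTE lj) mul0r.
Qed.
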